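(* For every $n\in\mathbb N$ (with $n\ge1$) let $\mathcal{A}_n:=(\ell^1(\mathrm{Cu}_2\setminus\{\lozenge\},\mu_n),\#)$, where $\mathrm{Cu}_2$ is the second Cuntz semigroup and $\mu_n$ is the quasi-weight on $\mathrm{Cu}_2\setminus\{\lozenge\}$ with $\mu_n(e)=1$ and $\mu_n(s)=n$ for $s\in\mathrm{Cu}_2\setminus\{e,\lozenge\}$. Then $(\mathcal{A}_n)$ is a sequence of properly infinite Banach algebras such that $\mathrm{Asy}(\mathcal{A}_n)$ is not properly infinite.
   Context: $\mathrm{Cu}_2$ is the monoid with identity $e$ and zero element $\lozenge$ (so $\lozenge s=\lozenge=s\lozenge$ for all $s$) generated by $a_1,a_2,b_1,b_2$ subject to the relations $a_1b_1=e=a_2b_2$ and $a_1b_2=\lozenge=a_2b_1$. A weight on a monoid $S$ with identity $e$ is a function $\omega:S\to(0,+\infty)$ with $\omega(st)\le\omega(s)\omega(t)$ for all $s,t\in S$ and $\omega(e)=1$. If $S$ has a zero element $\lozenge$, a quasi-weight is the restriction $\mu=\omega|_{S\setminus\{\lozenge\}}$ of a weight $\omega$ on $S$. Then $\ell^1(S\setminus\{\lozenge\},\mu)$ is the Banach space of $f:S\setminus\{\lozenge\}\to\mathbb C$ with $\|f\|_\mu=\sum_s|f(s)|\mu(s)<\infty$. It becomes a unital Banach algebra (unit $\delta_e$, of norm $1$) with the bounded bilinear product $\#$ determined by $\delta_s\#\delta_t=\delta_{st}$ if $st\ne\lozenge$ and $\delta_s\#\delta_t=0$ if $st=\lozenge$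 (equivalently, it is the quotient of the convolution algebra $\ell^1(S,\omega)$ by the ideal $\mathbb C\delta_\lozenge$). Here $\mu_n$ arises from the weight equal to $1$ at $e$ and $\lozenge$ and $n$ elsewhere. For a sequence $(\mathcal A_n)$ of Banach algebras, $\ell^\infty(\mathcal A_n)$ is the Banach algebra of all bounded sequences $(a_n)$ with $a_n\in\mathcal A_n$, with pointwise operations and the supremum norm; $c_0(\mathcal A_n)$ is the closed two-sided ideal of sequences with $\lim_{n\to\infty}\|a_n\|=0$; and $\mathrm{Asy}(\mathcal A_n)=\ell^\infty(\mathcal A_n)/c_0(\mathcal A_n)$ with the quotient norm. Two idempotents $p,q$ in an algebra $\mathcal A$ are equivalent, $p\sim q$, if there are $a,b\in\mathcal A$ with $p=ab$ and $q=ba$; they are orthogonal if $pq=0=qp$. A unital algebra $\mathcal A$ is properly infinite if there are orthogonal idempotents $p,q\in\mathcal A$ with $p\sim 1$ and $q\sim 1$. *)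

(* Defs.v *)
From HB Require Import structures.
From mathcomp Require Import all_boot all_order all_algebra generic_quotient.
From mathcomp Require Import boolp classical_sets functions cardinality fsbigop.
From mathcomp Require Import reals ereal topology normedtype sequences esum.
From mathcomp.real_closed Require Import complex.

Set Implicit Arguments.
Unset Strict Implicit.
Unset Printing Implicit Defensive.

Import Order.TTheory GRing.Theory Num.Theory.
Import numFieldNormedType.Exports.
Import ComplexField.Normc.

Local Open Scope classical_set_scope.
Local Open Scope ring_scope.

Section RealSums.
Variables (R : realType) (I : choiceType).
Implicit Types (D : set I) (f g h : I -> R).

(* Unordered sum of an absolutely summable real family: sum of the positive
   parts minus sum of the negative parts; meaningless (but total) otherwise. *)
Definition rsum D f : R :=
  fine (\esum_(i in D) (Num.max (f i) 0)%:E) -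
  fine (\esum_(i in D) (Num.max (- f i) 0)%:E).

Definition nsummable D f := (\esum_(i in D) (f i)%:E < +oo)%E.

Lemma nsum_fin D f : (forall i, D i -> 0 <= f i) -> nsummable D f ->
  (\esum_(i in D) (f i)%:E \is a fin_num)%E.
Proof. by move=> f0 fD; rewrite ge0_fin_numE// esum_ge0. Qed.

Lemma le_nsummable D f g : (forall i, D i -> f i <= g i) ->
  nsummable D g -> nsummable D f.
Proof. by move=> fg; apply: le_lt_trans; apply: le_esum => i /fg; rewrite lee_fin. Qed.

Lemma rsumE D f g h : (forall i, D i -> 0 <= g i) ->
  (forall i, D i -> 0 <= h i) -> (forall i, D i -> f i = g i - h i) ->
  nsummable D g -> nsummable D h ->
  rsum D f = fine (\esum_(i in D) (g i)%:E) - fine (\esum_(i in D) (h i)%:E).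
Proof.
move=> g0 h0 fE gD hD; rewrite /rsum.
have m0 (x : R) : 0 <= Num.max x 0 by rewrite le_max lexx orbT.
have pD : nsummable D (fun i => Num.max (f i) 0).
  apply: le_nsummable gD => i Di; rewrite ge_max g0// andbT fE//.
  by rewrite gerBl h0.
have nD : nsummable D (fun i => Num.max (- f i) 0).
  apply: le_nsummable hD => i Di; rewrite ge_max h0// andbT fE//.
  by rewrite opprB gerBl g0.
apply/eqP; rewrite subr_eq addrAC eq_sym subr_eq; apply/eqP.
rewrite -!fineD ?nsum_fin//.
rewrite -!esumD//; try by move=> i Di; rewrite lee_fin ?g0 ?h0.
congr fine; apply: eq_esum => i Di; rewrite -!EFinD; congr EFin.
rewrite fE// opprB.
case: (leP (g i) (h i)) => gh.
  rewrite (max_l (_ : 0 <= h i - g i)) ?subr_ge0// (max_r (_ : g i - h i <= 0)) ?subr_le0//.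
  by rewrite addrC subrK add0r.
rewrite (max_r (_ : h i - g i <= 0)) ?subr_le0 1?ltW//.
by rewrite (max_l (_ : 0 <= g i - h i)) ?subr_ge0 1?ltW// addr0 subrK.
Qed.

Lemma eq_rsum D f g : (forall i, D i -> f i = g i) -> rsum D f = rsum D g.
Proof.
by move=> fg; rewrite /rsum; congr (fine _ - fine _); apply: eq_esum => i Di; rewrite fg.
Qed.

Lemma nsummable_pos D f : nsummable D (fun i => `|f i|) ->
  nsummable D (fun i => Num.max (f i) 0).
Proof. by apply: le_nsummable => i _; rewrite ge_max ler_norm normr_ge0. Qed.

Lemma nsummable_neg D f : nsummable D (fun i => `|f i|) ->
  nsummable D (fun i => Num.max (- f i) 0).
Proof. by apply: le_nsummable => i _; rewrite ge_max -normrN ler_norm normr_ge0. Qed.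

Lemma max_sub (x : R) : x = Num.max x 0 - Num.max (- x) 0.
Proof.
case: (leP 0 x) => x0.
  by rewrite max_r ?subr0// oppr_le0.
by rewrite max_l ?sub0r ?opprK// oppr_ge0 ltW.
Qed.

Lemma max0_ge0 (x : R) : 0 <= Num.max x 0.
Proof. by rewrite le_max lexx orbT. Qed.

Lemma nsummableD D f g : (forall i, D i -> 0 <= f i) -> (forall i, D i -> 0 <= g i) ->
  nsummable D f -> nsummable D g -> nsummable D (fun i => f i + g i).
Proof.
move=> f0 g0 fD gD; rewrite /nsummable.
under eq_esum do rewrite EFinD.
by rewrite esumD ?lte_add_pinfty.
Qed.

Lemma nsummable_ge0 D f : (forall i, D i -> 0 <= f i) -> nsummable D f ->
  nsummable D (fun i => `|f i|).
Proof. by move=> f0; apply: le_nsummable => i Di; rewrite ger0_norm ?f0. Qed.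

Lemma rsumD D f g : nsummable D (fun i => `|f i|) -> nsummable D (fun i => `|g i|) ->
  rsum D (fun i => f i + g i) = rsum D f + rsum D g.
Proof.
move=> fD gD.
rewrite (@rsumE D _ (fun i => Num.max (f i) 0 + Num.max (g i) 0)
                    (fun i => Num.max (- f i) 0 + Num.max (- g i) 0)); last 5 first.
- by move=> i _; rewrite addr_ge0// max0_ge0.
- by move=> i _; rewrite addr_ge0// max0_ge0.
- by move=> i _; rewrite {1}(max_sub (f i)) {1}(max_sub (g i)) addrACA opprD.
- by apply: nsummableD; rewrite ?nsummable_pos// => i _; rewrite max0_ge0.
- by apply: nsummableD; rewrite ?nsummable_neg// => i _; rewrite max0_ge0.
have E u v : (forall i, D i -> 0 <= u i) -> (forall i, D i -> 0 <= v i) ->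
    nsummable D u -> nsummable D v ->
    fine (\esum_(i in D) (u i + v i)%:E) =
    fine (\esum_(i in D) (u i)%:E) + fine (\esum_(i in D) (v i)%:E).
  by move=> u0 v0 uD vD; under eq_esum do rewrite EFinD; rewrite esumD// fineD ?nsum_fin.
have m0 (h : I -> R) i : D i -> 0 <= Num.max (h i) 0 by rewrite max0_ge0.
rewrite (E _ _ (m0 f) (m0 g) (nsummable_pos fD) (nsummable_pos gD)).
rewrite (E _ _ (m0 (fun i => - f i)) (m0 (fun i => - g i)) (nsummable_neg fD) (nsummable_neg gD)).
by rewrite opprD addrACA.
Qed.

Lemma rsumN D f : rsum D (fun i => - f i) = - rsum D f.
Proof.
rewrite /rsum opprB; congr (_ - fine _).
by apply: eq_esum => i _; rewrite opprK.
Qed.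

Lemma esumZ D (c : R) f : 0 <= c ->
  (\esum_(i in D) (c * f i)%:E = c%:E * \esum_(i in D) (f i)%:E)%E.
Proof.
move=> c0; rewrite /esum -ereal_supZl//; last first.
  by apply/set0P; exists 0%E, set0; [exact: fsets_set0|rewrite fsbig_set0].
congr ereal_sup; rewrite image_comp; apply: eq_imagel => X [finX _] /=.
rewrite !fsbig_finite//= !sumEFin -EFinM; congr EFin.
by rewrite mulr_sumr.
Qed.

Lemma nsummableZ D (c : R) f : 0 <= c ->
  (forall i, D i -> 0 <= f i) ->
  nsummable D f -> nsummable D (fun i => c * f i).
Proof.
move=> c0 f0 fD; rewrite /nsummable esumZ// lte_mul_pinfty//.
Qed.

Lemma rsumZ_ge0 D (c : R) f : 0 <= c -> nsummable D (fun i => `|f i|) ->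
  rsum D (fun i => c * f i) = c * rsum D f.
Proof.
move=> c0 fD.
rewrite (@rsumE D _ (fun i => c * Num.max (f i) 0)
                    (fun i => c * Num.max (- f i) 0)); last 5 first.
- by move=> i _; rewrite mulr_ge0// max0_ge0.
- by move=> i _; rewrite mulr_ge0// max0_ge0.
- by move=> i _; rewrite {1}(max_sub (f i)) mulrBr.
- by apply: nsummableZ; rewrite ?nsummable_pos// => i _; rewrite max0_ge0.
- by apply: nsummableZ; rewrite ?nsummable_neg// => i _; rewrite max0_ge0.
rewrite !esumZ// /rsum mulrBr.
by rewrite !fineM ?nsum_fin//; try (exact: nsummable_pos || exact: nsummable_neg); move=> i _; rewrite max0_ge0.
Qed.

Lemma rsumZ D (c : R) f : nsummable D (fun i => `|f i|) ->
  rsum D (fun i => c * f i) = c * rsum D f.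
Proof.
move=> fD; case: (leP 0 c) => c0; first exact: rsumZ_ge0.
rewrite -[c]opprK mulNr -rsumZ_ge0 ?oppr_ge0 1?ltW// -rsumN.
by apply: eq_rsum => i _; rewrite !mulNr.
Qed.

Lemma rsum_le D f : nsummable D (fun i => `|f i|) ->
  rsum D f <= fine (\esum_(i in D) (`|f i|)%:E).
Proof.
move=> fD; rewrite /rsum lerBlDr -[leLHS]addr0 lerD//.
  rewrite fine_le ?nsum_fin ?nsummable_pos//; try by move=> i _; rewrite max0_ge0.
  by apply: le_esum => i _; rewrite lee_fin ge_max ler_norm normr_ge0.
by rewrite fine_ge0// esum_ge0// => i _; rewrite lee_fin max0_ge0.
Qed.

End RealSums.

Section RealSums2.
Variables (R : realType) (I J : choiceType).

Lemma reindex_rsum (P : set I) (Q : set J) (e : I -> J) (f : J -> R) :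
  set_bij P Q e -> rsum Q f = rsum P (f \o e).
Proof. by move=> eb; rewrite /rsum !(reindex_esum _ _ _ _ eb). Qed.

Lemma rsum_rsum (D : set I) (E : I -> set J) (f : I -> J -> R) :
  nsummable (D `*`` E) (fun k => `|f k.1 k.2|) ->
  rsum D (fun i => rsum (E i) (f i)) = rsum (D `*`` E) (fun k => f k.1 k.2).
Proof.
move=> fDE.
have key (g : I -> J -> R) : (forall i j, 0 <= g i j) ->
    (forall i j, g i j <= `|f i j|) ->
  [/\ (forall i, D i -> \esum_(j in E i) (g i j)%:E \is a fin_num)%E,
   (\esum_(i in D) (fine (\esum_(j in E i) (g i j)%:E))%:E =
     \esum_(k in D `*`` E) (g k.1 k.2)%:E)%E &
     nsummable (D `*`` E) (fun k => g k.1 k.2)].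
  move=> g0 gf.
  have gS : nsummable (D `*`` E) (fun k => g k.1 k.2).
    by apply: le_nsummable fDE => k _; exact: gf.
  have gE := gS; rewrite /nsummable -(@esum_esum _ _ _ D E (fun i j => (g i j)%:E)) in gE; last first.
    by move=> i j _ _; rewrite lee_fin.
  have fing i : D i -> (\esum_(j in E i) (g i j)%:E \is a fin_num)%E.
    move=> Di; rewrite ge0_fin_numE ?esum_ge0//; last by move=> j _; rewrite lee_fin.
    have := @summable_pinfty _ _ D (fun i => \esum_(j in E i) (g i j)%:E)%E.
    have ge0 k : (0 <= \esum_(j in E k) (g k j)%:E)%E.
      by rewrite esum_ge0// => j _; rewrite lee_fin.
    move=> /(_ _ i Di); rewrite gee0_abs//; apply.
    by rewrite /summable; under eq_esum do rewrite gee0_abs//.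
  split => //; rewrite -(@esum_esum _ _ _ D E (fun i j => (g i j)%:E))//; last by move=> i j _ _; rewrite lee_fin.
  by apply: eq_esum => i Di; rewrite fineK// fing.
have m0 := @max0_ge0 R.
have [p1 p2 p3] := key (fun i j => Num.max (f i j) 0) (fun _ _ => m0 _)
  (fun i j => ltac:(by rewrite ge_max ler_norm normr_ge0)).
have [n1 n2 n3] := key (fun i j => Num.max (- f i j) 0) (fun _ _ => m0 _)
  (fun i j => ltac:(by rewrite ge_max -normrN ler_norm normr_ge0)).
rewrite (@rsumE _ _ D _ (fun i => fine (\esum_(j in E i) (Num.max (f i j) 0)%:E))
  (fun i => fine (\esum_(j in E i) (Num.max (- f i j) 0)%:E)))//.
- by rewrite p2 n2.
- by move=> i _; rewrite fine_ge0// esum_ge0// => j _; rewrite lee_fin.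
- by move=> i _; rewrite fine_ge0// esum_ge0// => j _; rewrite lee_fin.
- by rewrite /nsummable p2.
- by rewrite /nsummable n2.
Qed.

End RealSums2.

Section ComplexSums.
Variables (R : realType) (I : choiceType).
Implicit Types (D : set I) (f g : I -> R[i]).

Definition csum D f : R[i] :=
  (rsum D (fun i => complex.Re (f i)) +i* rsum D (fun i => complex.Im (f i)))%C.

Definition csummable D f := nsummable D (fun i => normc (f i)).

Lemma normc_ge0 (x : R[i]) : 0 <= normc x.
Proof. by case: x => a b /=; rewrite sqrtr_ge0. Qed.

Lemma Re_le_normc (x : R[i]) : `|complex.Re x| <= normc x.
Proof. by case: x => a b /=; rewrite -sqrtr_sqr ler_wsqrtr// lerDl sqr_ge0. Qed.

Lemma Im_le_normc (x : R[i]) : `|complex.Im x| <= normc x.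
Proof. by case: x => a b /=; rewrite -sqrtr_sqr ler_wsqrtr// lerDr sqr_ge0. Qed.

Lemma normcE (x : R[i]) : `|x| = (normc x)%:C%C.
Proof. by []. Qed.

Lemma normc_real (r : R) : 0 <= r -> normc (r%:C)%C = r.
Proof. by move=> r0; rewrite /= expr0n addr0 sqrtr_sqr ger0_norm. Qed.

Lemma ler_normcD (x y : R[i]) : normc (x + y) <= normc x + normc y.
Proof. by have := ler_normD x y; rewrite !normcE -rmorphD/= lecR. Qed.

Lemma normcN (x : R[i]) : normc (- x) = normc x.
Proof. by have /complexI := normrN x. Qed.

Lemma csummable_Re D f : csummable D f -> nsummable D (fun i => `|complex.Re (f i)|).
Proof. by apply: le_nsummable => i _; exact: Re_le_normc. Qed.

Lemma csummable_Im D f : csummable D f -> nsummable D (fun i => `|complex.Im (f i)|).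
Proof. by apply: le_nsummable => i _; exact: Im_le_normc. Qed.

Lemma eq_csum D f g : (forall i, D i -> f i = g i) -> csum D f = csum D g.
Proof. by move=> fg; congr Complex; apply: eq_rsum => i Di; rewrite fg. Qed.

Lemma csummableD D f g : csummable D f -> csummable D g ->
  csummable D (fun i => f i + g i).
Proof.
move=> fD gD; have := nsummableD (fun i _ => normc_ge0 (f i)) (fun i _ => normc_ge0 (g i)) fD gD.
by apply: le_nsummable => i _; exact: ler_normcD.
Qed.

Lemma csummableZ D (c : R[i]) f : csummable D f -> csummable D (fun i => c * f i).
Proof.
move=> fD; have := nsummableZ (normc_ge0 c) (fun i _ => normc_ge0 (f i)) fD.
by apply: le_nsummable => i _; rewrite normcM.
Qed.

Lemma csumD D f g : csummable D f -> csummable D g ->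
  csum D (fun i => f i + g i) = csum D f + csum D g.
Proof.
move=> fD gD; rewrite /csum.
have -> : rsum D (fun i => complex.Re (f i + g i)) =
  rsum D (fun i => complex.Re (f i)) + rsum D (fun i => complex.Re (g i)).
  rewrite -rsumD ?csummable_Re//.
  by apply: eq_rsum => i _; case: (f i) (g i) => [? ?] [].
have -> : rsum D (fun i => complex.Im (f i + g i)) =
  rsum D (fun i => complex.Im (f i)) + rsum D (fun i => complex.Im (g i)).
  rewrite -rsumD ?csummable_Im//.
  by apply: eq_rsum => i _; case: (f i) (g i) => [? ?] [].
by [].
Qed.

Lemma csumZ D (c : R[i]) f : csummable D f ->
  csum D (fun i => c * f i) = c * csum D f.
Proof.
move=> fD; rewrite /csum.
have fR := csummable_Re fD; have fI := csummable_Im fD.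
have ZS (a : R) (g : I -> R) : nsummable D (fun i => `|g i|) ->
    nsummable D (fun i => `|a * g i|).
  move=> /(nsummableZ (normr_ge0 a) (fun i _ => normr_ge0 _)).
  by apply: le_nsummable => i _; rewrite normrM.
case: c => a b.
have -> : rsum D (fun i => complex.Re ((a +i* b)%C * f i)) =
  a * rsum D (fun i => complex.Re (f i)) - b * rsum D (fun i => complex.Im (f i)).
  rewrite -mulNr -!rsumZ// -rsumD ?ZS//.
  by apply: eq_rsum => i _; case: (f i) => ? ? /=; rewrite mulNr.
have -> : rsum D (fun i => complex.Im ((a +i* b)%C * f i)) =
  a * rsum D (fun i => complex.Im (f i)) + b * rsum D (fun i => complex.Re (f i)).
  rewrite -!rsumZ// -rsumD ?ZS//.
  by apply: eq_rsum => i _; case: (f i) => ? ? /=.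
by [].
Qed.

Lemma normc_csum D f : csummable D f ->
  ((normc (csum D f))%:E <= \esum_(i in D) (normc (f i))%:E)%E.
Proof.
move=> fD.
have [->|S0] := eqVneq (csum D f) 0.
  by rewrite normc0 esum_ge0// => i _; rewrite lee_fin normc_ge0.
have N0 : (normc (csum D f))%:C%C != 0 :> R[i] by rewrite -normcE normr_eq0.
pose c := (normc (csum D f))%:C%C / csum D f.
have c1 : normc c = 1.
  rewrite /c normcM normcV normc_real ?normc_ge0// divff//.
  by apply: contra N0 => /eqP ->.
have cE : c * csum D f = (normc (csum D f))%:C%C by rewrite /c divfK.
have -> : normc (csum D f) = rsum D (fun i => complex.Re (c * f i)).
  by have /(congr1 (@complex.Re R)) := cE; rewrite -csumZ.
have cD := csummableZ c fD.
rewrite (@le_trans _ _ (\esum_(i in D) (`|complex.Re (c * f i)|)%:E)%E)//.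
  rewrite -[leRHS]fineK ?nsum_fin ?csummable_Re// lee_fin.
  exact/rsum_le/csummable_Re.
apply: le_esum => i _; rewrite lee_fin (le_trans (Re_le_normc _))//.
by rewrite normcM c1 mul1r.
Qed.

Lemma csum0 D f : (forall i, D i -> f i = 0) -> csum D f = 0.
Proof.
move=> f0; rewrite (@eq_csum _ f (fun=> 0))//.
by rewrite /csum /rsum !esum1 ?subrr//= => i _; rewrite ?oppr0 maxxx.
Qed.

Lemma csum_only D f (i0 : I) : D i0 -> (forall i, D i -> i != i0 -> f i = 0) ->
  csum D f = f i0.
Proof.
move=> Di0 f0.
have one (g : I -> R) : (forall i, D i -> i != i0 -> g i = 0) -> rsum D g = g i0.
  move=> g0; rewrite [RHS]max_sub /rsum.
  have E (h : I -> R) : (forall i, D i -> i != i0 -> h i = 0) -> 0 <= h i0 ->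
      fine (\esum_(i in D) (h i)%:E) = h i0.
    move=> h0 hi0; rewrite (_ : (\esum_(i in D) (h i)%:E = \esum_(i in [set i0]) (h i)%:E)%E).
      by rewrite esum_set1// lee_fin.
    rewrite esum_mkcond [RHS]esum_mkcond; apply: eq_esum => i _.
    have [->|ii0] := eqVneq i i0; first by rewrite !mem_set.
    rewrite [in RHS]ifF; last by apply/negP; rewrite inE; apply/eqP.
    by case: ifPn => // /set_mem Di; rewrite h0.
  by rewrite !E ?max0_ge0// => i Di /(g0 i Di) ->; rewrite ?oppr0 maxxx.
rewrite /csum !one; first by case: (f i0).
by move=> i Di /(f0 i Di) ->.
by move=> i Di /(f0 i Di) ->.
Qed.

End ComplexSums.

Section ComplexSums2.
Variables (R : realType) (I J : choiceType).

Lemma reindex_csum (P : set I) (Q : set J) (e : I -> J) (f : J -> R[i]) :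
  set_bij P Q e -> csum Q f = csum P (f \o e).
Proof. by move=> eb; rewrite /csum !(reindex_rsum _ eb). Qed.

Lemma csum_csum (D : set I) (E : I -> set J) (f : I -> J -> R[i]) :
  csummable (D `*`` E) (fun k => f k.1 k.2) ->
  csum D (fun i => csum (E i) (f i)) = csum (D `*`` E) (fun k => f k.1 k.2).
Proof.
by move=> fS; rewrite /csum !rsum_rsum//; [apply: csummable_Im|apply: csummable_Re].
Qed.

End ComplexSums2.

(* Monoids with a zero element distinct from the identity. *)
HB.mixin Record Monoid_hasZero S of Monoid S := {
  mzero : S;
  mul0m : forall s : S, (mzero * s)%g = mzero;
  mulm0 : forall s : S, (s * mzero)%g = mzero;
  oneg_neq0 : 1%g != mzero
}.

#[short(type="zmonoidType")]
HB.structure Definition ZMonoid := {S of Monoid_hasZero S & Monoid S}.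

Record weight (R : realType) (S : zmonoidType) := Weight {
  weight_fun :> S -> R;
  weight_gt0 : forall s, 0 < weight_fun s;
  weightM : forall s t, weight_fun (s * t)%g <= weight_fun s * weight_fun t;
  weight1 : weight_fun 1%g = 1
}.

Notation nonzero S := {s : S | s != mzero}.

Section WeightedSums.
Variables (R : realType) (S : zmonoidType) (w : weight R S).
Implicit Types (a b : nonzero S -> R) (f g h : nonzero S -> R[i]).

Definition factorizations (u : nonzero S) : set (nonzero S * nonzero S) :=
  [set p | val p.1 * val p.2 = val u]%g.
Local Notation P := factorizations.

(* Only the restriction of w to the nonzero elements, i.e. the quasi-weight,
   enters the sum. *)
Definition wsum a := (\esum_(s in setT) (a s * w (val s))%:E)%E.

Lemma wsum_ge0 a : (forall s, 0 <= a s) -> (0 <= wsum a)%E.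
Proof.
by move=> a0; rewrite esum_ge0// => s _; rewrite lee_fin mulr_ge0// ltW// weight_gt0.
Qed.

Lemma le_wsum a b : (forall s, a s <= b s) -> (wsum a <= wsum b)%E.
Proof.
move=> ab; apply: le_esum => s _; rewrite lee_fin ler_wpM2r//.
by rewrite ltW// weight_gt0.
Qed.

Lemma wsum_le1 a s : (forall s, 0 <= a s) -> ((a s * w (val s))%:E <= wsum a)%E.
Proof.
move=> a0; have aw t : 0 <= a t * w (val t) by rewrite mulr_ge0// ltW// weight_gt0.
rewrite /wsum (esumID [set s])//; last by move=> i _; rewrite lee_fin.
rewrite setTI esum_set1 ?lee_fin// leeDl// esum_ge0// => i _.
by rewrite lee_fin.
Qed.

Lemma wsumD a b : (forall s, 0 <= a s) -> (forall s, 0 <= b s) ->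
  wsum (fun s => a s + b s) = (wsum a + wsum b)%E.
Proof.
move=> a0 b0; rewrite /wsum -esumD//.
- by apply: eq_esum => s _; rewrite mulrDl EFinD.
- by move=> s _; rewrite lee_fin mulr_ge0// ltW// weight_gt0.
- by move=> s _; rewrite lee_fin mulr_ge0// ltW// weight_gt0.
Qed.

Lemma wsumZ (c : R) a : 0 <= c -> wsum (fun s => c * a s) = (c%:E * wsum a)%E.
Proof.
by move=> c0; rewrite /wsum -esumZ//; apply: eq_esum => s _; rewrite mulrA.
Qed.

Lemma fact_bound a b : (forall s, 0 <= a s) -> (forall s, 0 <= b s) ->
  (wsum a < +oo -> wsum b < +oo ->
  \esum_(u in setT) \esum_(p in P u)
     ((a p.1 * w (val p.1)) * (b p.2 * w (val p.2)))%:E <= wsum a * wsum b)%E.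
Proof.
move=> a0 b0 aw bw.
have w0 s : 0 <= w s by rewrite ltW// weight_gt0.
have ab0 (p : nonzero S * nonzero S) :
  (0 <= ((a p.1 * w (val p.1)) * (b p.2 * w (val p.2)))%:E)%E.
  by rewrite lee_fin !mulr_ge0.
rewrite (@esum_esum _ _ _ setT P (fun _ p => ((a p.1 * w (val p.1)) * (b p.2 * w (val p.2)))%:E))//.
have inj2 : set_inj ([set: nonzero S] `*`` P) snd.
  move=> [u p] [v q]; rewrite !inE/= => -[_ up] [_ vq] pq.
  congr pair => //; apply: val_inj; rewrite -up -vq pq//.
rewrite -(@esum_image _ _ _ _ snd (fun p => ((a p.1 * w (val p.1)) * (b p.2 * w (val p.2)))%:E))//.
apply: (@le_trans _ _ (\esum_(p in [set: nonzero S] `*`` (fun=> [set: nonzero S]))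
  ((a p.1 * w (val p.1)) * (b p.2 * w (val p.2)))%:E)%E).
  rewrite esum_mkcond [leRHS]esum_mkcond; apply: le_esum => p _.
  by rewrite [in leRHS]ifT ?inE//; case: ifP.
rewrite -(@esum_esum _ _ _ setT (fun=> setT) (fun s t => ((a s * w (val s)) * (b t * w (val t)))%:E)); last first.
  by move=> s t _ _; rewrite lee_fin !mulr_ge0.
under eq_esum.
  move=> s _; rewrite (@esumZ _ _ _ (a s * w (val s)) (fun t => b t * w (val t))) ?mulr_ge0//.
  rewrite -/(wsum b) -(@fineK _ (wsum b)) ?ge0_fin_numE ?wsum_ge0// muleC -EFinM.
  over.
rewrite esumZ ?fine_ge0 ?wsum_ge0// fineK ?ge0_fin_numE ?wsum_ge0//.
by rewrite muleC.
Qed.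

Lemma conv_fin a b : (forall s, 0 <= a s) -> (forall s, 0 <= b s) ->
  (wsum a < +oo)%E -> (wsum b < +oo)%E -> forall u,
  nsummable (P u) (fun p => a p.1 * b p.2).
Proof.
move=> a0 b0 aw bw u.
have w0 s : 0 <= w s by rewrite ltW// weight_gt0.
have F0 u' : (0 <= \esum_(p in P u')
     ((a p.1 * w (val p.1)) * (b p.2 * w (val p.2)))%:E)%E.
  by rewrite esum_ge0// => p _; rewrite lee_fin !mulr_ge0.
have : nsummable (P u) (fun p => (a p.1 * w (val p.1)) * (b p.2 * w (val p.2))).
  rewrite /nsummable; apply: le_lt_trans (_ : _ <= wsum a * wsum b)%E _; last first.
    by rewrite lte_mul_pinfty ?wsum_ge0// ge0_fin_numE ?wsum_ge0.
  apply: le_trans (fact_bound a0 b0 aw bw).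
  rewrite (esumID [set u])// setTI esum_set1// leeDl// esum_ge0//.
move=> /(@nsummableZ _ _ _ (w (val u))^-1 _ _) => /(_ _ _)/wrap[].
- by rewrite invr_ge0.
- by move=> p _; rewrite !mulr_ge0.
apply: le_nsummable => p up.
rewrite ler_pdivlMl ?weight_gt0// mulrACA mulrC ler_wpM2l ?mulr_ge0//.
by rewrite -up weightM.
Qed.

Lemma wsum_conv a b : (forall s, 0 <= a s) -> (forall s, 0 <= b s) ->
  (wsum a < +oo)%E -> (wsum b < +oo)%E ->
  (wsum (fun u => fine (\esum_(p in P u) (a p.1 * b p.2)%:E)%E)
    <= wsum a * wsum b)%E.
Proof.
move=> a0 b0 aw bw; apply: le_trans (fact_bound a0 b0 aw bw).
have w0 s : 0 <= w s by rewrite ltW// weight_gt0.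
apply: le_esum => u _; rewrite EFinM fineK ?nsum_fin//; last 2 first.
- by move=> p _; rewrite mulr_ge0.
- exact: conv_fin.
rewrite muleC -esumZ//; apply: le_esum => p up; rewrite lee_fin mulrACA mulrC.
by rewrite ler_wpM2l ?mulr_ge0// -up weightM.
Qed.

(* normc is the modulus as an element of R, whereas `|_| on R[i] is R[i]-valued. *)
Definition l1_pred f : bool := (wsum (fun s => normc (f s)) < +oo)%E.

Lemma conv_csummable f g u : l1_pred f -> l1_pred g ->
  csummable (P u) (fun p => f p.1 * g p.2).
Proof.
move=> fl gl; have := conv_fin (fun s => normc_ge0 (f s)) (fun s => normc_ge0 (g s)) fl gl u.
by apply: le_nsummable => p _; rewrite normcM.
Qed.

(* The product #: pairs (s, t) with st = zero contribute to no u, see also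
   l1_deltaM. *)
Definition conv f g u : R[i] := csum (P u) (fun p => f p.1 * g p.2).

Lemma wsum_normc_conv f g : l1_pred f -> l1_pred g ->
  (wsum (fun s => normc (conv f g s)) <=
   wsum (fun s => normc (f s)) * wsum (fun s => normc (g s)))%E.
Proof.
move=> fl gl.
have := wsum_conv (fun s => normc_ge0 (f s)) (fun s => normc_ge0 (g s)) fl gl.
apply: le_trans; apply: le_wsum => u.
have fgu := conv_csummable u fl gl.
rewrite -lee_fin (le_trans (normc_csum fgu))// fineK ?nsum_fin//.
- by apply: le_esum => p _; rewrite normcM.
- by move=> p _; rewrite mulr_ge0// normc_ge0.
- exact: (conv_fin (fun s => normc_ge0 (f s)) (fun s => normc_ge0 (g s))).
Qed.

Lemma conv_l1 f g : l1_pred f -> l1_pred g -> l1_pred (conv f g).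
Proof.
move=> fl gl; apply: le_lt_trans (wsum_normc_conv fl gl) _.
have n0 f' : (0 <= wsum (fun s => normc (f' s)))%E.
  by apply: wsum_ge0 => s; exact: normc_ge0.
by rewrite lte_mul_pinfty// ge0_fin_numE.
Qed.

Let T (u : nonzero S) : set (nonzero S * nonzero S * nonzero S) :=
  [set p | val p.1.1 * val p.1.2 * val p.2 = val u]%g.

Let absconv f g : nonzero S -> R :=
  fun u => fine (\esum_(p in P u) (normc (f p.1) * normc (g p.2))%:E)%E.

Let absconvE f g u : l1_pred f -> l1_pred g ->
  ((absconv f g u)%:E = \esum_(p in P u) (normc (f p.1) * normc (g p.2))%:E)%E.
Proof.
move=> fl gl; rewrite fineK// nsum_fin//.
  by move=> p _; rewrite mulr_ge0 ?normc_ge0.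
exact: (conv_fin (fun s => normc_ge0 (f s)) (fun s => normc_ge0 (g s))).
Qed.

Let absconv_ge0 f g u : 0 <= absconv f g u.
Proof. by rewrite fine_ge0// esum_ge0// => p _; rewrite lee_fin mulr_ge0 ?normc_ge0. Qed.

Let absconv_l1 f g : l1_pred f -> l1_pred g -> (wsum (absconv f g) < +oo)%E.
Proof.
move=> fl gl; apply: le_lt_trans
 (wsum_conv (fun s => normc_ge0 (f s)) (fun s => normc_ge0 (g s)) fl gl) _.
have n0 f' : (0 <= wsum (fun s => normc (f' s)))%E.
  by apply: wsum_ge0 => s; exact: normc_ge0.
by rewrite lte_mul_pinfty// ge0_fin_numE.
Qed.

Lemma convAl f g h u : l1_pred f -> l1_pred g -> l1_pred h ->
  conv (conv f g) h u = csum (T u) (fun p => f p.1.1 * g p.1.2 * h p.2).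
Proof.
move=> fl gl hl; rewrite {1}/conv.
under eq_csum => p _.
  rewrite mulrC /conv -csumZ; last exact: conv_csummable.
  over.
pose F (p q : nonzero S * nonzero S) := h p.2 * (f q.1 * g q.2).
rewrite (@csum_csum _ _ _ (P u) (fun p => P p.1) F); last first.
  rewrite /csummable /nsummable.
  rewrite -(@esum_esum _ _ _ (P u) (fun p => P p.1) (fun p q => (normc (F p q))%:E)); last first.
    by move=> p q _ _; rewrite lee_fin normc_ge0.
  under eq_esum.
    move=> p _; under eq_esum do rewrite /F !normcM.
    rewrite esumZ ?normc_ge0// -absconvE// -EFinM mulrC; over.
  exact: conv_fin (absconv_ge0 f g) (fun s => normc_ge0 (h s)) (absconv_l1 fl gl) hl u.
rewrite (@reindex_csum _ _ _ (P u `*`` (fun p => P p.1)) (T u)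
  (fun k => (k.2.1, k.2.2, k.1.2))); last first.
  split.
  - move=> [[x v] [s t]] [/= xv st]; rewrite /T/= st; exact: xv.
  - move=> [[x v] [s t]] [[x' v'] [s' t']]; rewrite !inE /= => -[/= xv st] [/= xv' st'].
    move=> [ss tt vv]; subst; congr (_, _, _); apply: val_inj.
    by rewrite -st -st'.
  - move=> [[s t] v] /= stv.
    have st0 : (val s * val t)%g != mzero.
      apply: contraNneq (valP u) => st0.
      by rewrite -stv/= st0 mul0m.
    exists ((@exist S (fun s => s != mzero) _ st0, v), (s, t)) => //=.
by apply: eq_csum => -[[x v] [s t]] _; rewrite /F/= mulrC.
Qed.

Lemma convAr f g h u : l1_pred f -> l1_pred g -> l1_pred h ->
  conv f (conv g h) u = csum (T u) (fun p => f p.1.1 * g p.1.2 * h p.2).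
Proof.
move=> fl gl hl; rewrite {1}/conv.
under eq_csum => p _.
  rewrite /conv -csumZ; last exact: conv_csummable.
  over.
pose F (p q : nonzero S * nonzero S) := f p.1 * (g q.1 * h q.2).
rewrite (@csum_csum _ _ _ (P u) (fun p => P p.2) F); last first.
  rewrite /csummable /nsummable.
  rewrite -(@esum_esum _ _ _ (P u) (fun p => P p.2) (fun p q => (normc (F p q))%:E)); last first.
    by move=> p q _ _; rewrite lee_fin normc_ge0.
  under eq_esum.
    move=> p _; under eq_esum do rewrite /F !normcM.
    rewrite esumZ ?normc_ge0// -absconvE// -EFinM; over.
  exact: conv_fin (fun s => normc_ge0 (f s)) (absconv_ge0 g h) fl (absconv_l1 gl hl) u.
rewrite (@reindex_csum _ _ _ (P u `*`` (fun p => P p.2)) (T u)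
  (fun k => (k.1.1, k.2.1, k.2.2))); last first.
  split.
  - move=> [[s y] [t v]] [/= sy tv]; rewrite /T/= -mulgA tv; exact: sy.
  - move=> [[s y] [t v]] [[s' y'] [t' v']]; rewrite !inE /= => -[/= sy tv] [/= sy' tv'].
    move=> [ss tt vv]; subst; congr (_, _, _); apply: val_inj.
    by rewrite -tv -tv'.
  - move=> [[s t] v] /= stv.
    have tv0 : (val t * val v)%g != mzero.
      apply: contraNneq (valP u) => tv0.
      by rewrite -stv/= -mulgA tv0 mulm0.
    exists ((s, @exist S (fun s => s != mzero) _ tv0), (t, v)) => //=.
    by split => //=; rewrite /P/= mulgA.
by apply: eq_csum => -[[s y] [t v]] _; rewrite /F/= mulrA.
Qed.


End WeightedSums.

Section L1.
Variables (R : realType) (S : zmonoidType) (w : weight R S).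

Record l1 := L1 { l1_val :> nonzero S -> R[i]; _ : l1_pred w l1_val }.
HB.instance Definition _ := [isSub for l1_val].
HB.instance Definition _ := [Choice of l1 by <:].

Let w0 s : 0 <= w s. Proof. by rewrite ltW// weight_gt0. Qed.

Lemma l1_submod : GRing.subsemimod_closed (l1_pred w).
Proof.
split; first split.
- rewrite unfold_in /l1_pred /wsum esum1// => s _.
  by rewrite normc0 mul0r.
- move=> f g fl gl; rewrite unfold_in.
  have := lte_add_pinfty fl gl; rewrite -wsumD; try by move=> s; exact: normc_ge0.
  apply: le_lt_trans; apply: le_wsum => s; exact: ler_normcD.
- move=> c f fl; rewrite unfold_in.
  have cfl : (wsum w (fun s => (normc c * normc (f s))%R) < +oo)%E.
    by rewrite wsumZ ?normc_ge0// lte_mul_pinfty ?lee_fin ?normc_ge0.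
  by apply: le_lt_trans cfl; apply: le_wsum => s; rewrite normcM.
Qed.

HB.instance Definition _ :=
  GRing.SubChoice_isSubLmodule.Build R[i] (nonzero S -> R[i]) (l1_pred w) l1 l1_submod.

Lemma l1P (f : l1) : l1_pred w f. Proof. exact: (valP f). Qed.

Lemma l1_eq (f g : l1) : f =1 g -> f = g.
Proof. by move=> fg; apply: val_inj; apply: funext. Qed.

Definition l1_mul (f g : l1) : l1 := L1 (conv_l1 (l1P f) (l1P g)).

Definition delta_fun (s : nonzero S) : nonzero S -> R[i] := fun t => (t == s)%:R.

Lemma delta_l1 s : l1_pred w (delta_fun s).
Proof.
rewrite /l1_pred /wsum (esumID [set s])//; last first.
  by move=> t _; rewrite lee_fin mulr_ge0// normc_ge0.
rewrite setTI esum_set1; last by rewrite lee_fin mulr_ge0// normc_ge0.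
rewrite esum1 ?adde0 ?ltry// => t [_ /eqP/negPf ts].
by rewrite /delta_fun ts normc0 mul0r.
Qed.

Definition l1_delta s : l1 := L1 (delta_l1 s).

Definition one_nz : nonzero S :=
  exist (fun s => s != mzero) 1%g (@oneg_neq0 S).

Definition l1_one : l1 := l1_delta one_nz.

Lemma l1_mulA : associative l1_mul.
Proof.
move=> f g h; apply: l1_eq => u /=.
by rewrite (@convAl _ _ w) ?(@convAr _ _ w)//; exact: l1P.
Qed.

Lemma l1_mul1 : left_id l1_one l1_mul.
Proof.
move=> f; apply: l1_eq => u /=; rewrite /conv.
rewrite (@csum_only _ _ _ _ (one_nz, u))/=.
- by rewrite /delta_fun eqxx mul1r.
- by rewrite /factorizations/= mul1g.
- move=> [s t]; rewrite /factorizations/= => st ne.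
  rewrite /delta_fun; have [sE|] := eqVneq s one_nz; last by rewrite mul0r.
  case/eqP: ne; subst s; congr pair; apply: val_inj.
  by move: st; rewrite /= mul1g.
Qed.

Lemma l1_mulr1 : right_id l1_one l1_mul.
Proof.
move=> f; apply: l1_eq => u /=; rewrite /conv.
rewrite (@csum_only _ _ _ _ (u, one_nz))/=.
- by rewrite /delta_fun eqxx mulr1.
- by rewrite /factorizations/= mulg1.
- move=> [s t]; rewrite /factorizations/= => st ne.
  rewrite /delta_fun; have [sE|] := eqVneq t one_nz; last by rewrite mulr0.
  case/eqP: ne; subst t; congr pair; apply: val_inj.
  by move: st; rewrite /= mulg1.
Qed.

Lemma l1_mulDl : left_distributive l1_mul +%R.
Proof.
move=> f g h; apply: l1_eq => u /=; rewrite /conv -[RHS]csumD.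
- by apply: eq_csum => p _; rewrite -mulrDl.
- by apply: (@conv_csummable _ _ w); exact: l1P.
- by apply: (@conv_csummable _ _ w); exact: l1P.
Qed.

Lemma l1_mulDr : right_distributive l1_mul +%R.
Proof.
move=> f g h; apply: l1_eq => u /=; rewrite /conv -[RHS]csumD.
- by apply: eq_csum => p _; rewrite -mulrDr.
- by apply: (@conv_csummable _ _ w); exact: l1P.
- by apply: (@conv_csummable _ _ w); exact: l1P.
Qed.

Lemma l1_one_neq0 : l1_one != 0.
Proof.
apply/eqP => /(congr1 (fun f : l1 => f one_nz)) /eqP.
by rewrite /= /delta_fun eqxx oner_eq0.
Qed.

HB.instance Definition _ := GRing.Zmodule_isNzRing.Build l1
  l1_mulA l1_mul1 l1_mulr1 l1_mulDl l1_mulDr l1_one_neq0.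

Lemma l1_deltaM (s t : nonzero S) :
  l1_delta s * l1_delta t =
    if insub (val s * val t)%g is Some u then l1_delta u else 0.
Proof.
apply: l1_eq => u; case: insubP => [v _ vst|st0].
  rewrite /= /delta_fun; have [->|uv] := eqVneq u v.
    rewrite /conv (@csum_only _ _ _ _ (s, t))/= /delta_fun ?eqxx ?mulr1//.
    move=> [x y] _ xy /=; have [xs|] := eqVneq x s; last by rewrite mul0r.
    have [yt|] := eqVneq y t; last by rewrite mulr0.
    by move: xy; rewrite xs yt eqxx.
  rewrite /conv csum0// => -[x y] xyu /=; rewrite /delta_fun.
  have [xs|] := eqVneq x s; last by rewrite mul0r.
  have [yt|] := eqVneq y t; last by rewrite mulr0.
  case/eqP: uv; apply: val_inj; rewrite vst -xs -yt; exact: esym.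
rewrite /= /conv csum0// => -[x y] xyu /=; rewrite /delta_fun.
have [xs|] := eqVneq x s; last by rewrite mul0r.
have [yt|] := eqVneq y t; last by rewrite mulr0.
case/negP: st0; rewrite -xs -yt; move: xyu; rewrite /factorizations/= => ->.
exact: valP u.
Qed.

Lemma l1_scaleAl (c : R[i]) (f g : l1) : c *: (f * g) = (c *: f) * g.
Proof.
apply: l1_eq => u /=; rewrite /conv -[LHS]csumZ.
- by apply: eq_csum => p _; rewrite mulrA.
- by apply: (@conv_csummable _ _ w); exact: l1P.
Qed.

Lemma l1_scaleAr (c : R[i]) (f g : l1) : c *: (f * g) = f * (c *: g).
Proof.
apply: l1_eq => u /=; rewrite /conv -[LHS]csumZ.
- by apply: eq_csum => p _; rewrite mulrCA.
- by apply: (@conv_csummable _ _ w); exact: l1P.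
Qed.

HB.instance Definition _ := GRing.Lmodule_isLalgebra.Build R[i] l1 l1_scaleAl.
HB.instance Definition _ := GRing.Lalgebra_isAlgebra.Build R[i] l1 l1_scaleAr.

Definition l1_norm (f : l1) : R := fine (wsum w (fun s => normc (f s))).

Lemma l1_normE (f : l1) : ((l1_norm f)%:E = wsum w (fun s => normc (f s)))%E.
Proof.
have f0 : (0 <= wsum w (fun s => normc (f s)))%E.
  by apply: wsum_ge0 => s; exact: normc_ge0.
by rewrite fineK// ge0_fin_numE//; exact: l1P.
Qed.

Lemma l1_normD (f g : l1) : l1_norm (f + g) <= l1_norm f + l1_norm g.
Proof.
rewrite -lee_fin EFinD !l1_normE -wsumD; try by move=> s; exact: normc_ge0.
by apply: le_wsum => s; exact: ler_normcD.
Qed.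

Lemma l1_normZ (c : R[i]) (f : l1) : l1_norm (c *: f) = normc c * l1_norm f.
Proof.
apply: EFin_inj; rewrite EFinM !l1_normE -wsumZ ?normc_ge0//.
by apply: eq_esum => s _; rewrite normcM.
Qed.

Lemma l1_norm_coef (f : l1) s : normc (f s) * w (val s) <= l1_norm f.
Proof.
rewrite -lee_fin l1_normE.
by apply: (@wsum_le1 _ _ w (fun s => normc (f s))) => t; exact: normc_ge0.
Qed.

Lemma l1_norm_eq0 (f : l1) : l1_norm f = 0 -> f = 0.
Proof.
move=> f0; apply: l1_eq => s; apply: eq0_normc; apply: le_anti.
rewrite normc_ge0 andbT; have := l1_norm_coef f s; rewrite f0.
by rewrite pmulr_lle0// weight_gt0.
Qed.

Lemma l1_normM (f g : l1) : l1_norm (f * g) <= l1_norm f * l1_norm g.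
Proof.
by rewrite -lee_fin EFinM !l1_normE; apply: wsum_normc_conv; exact: l1P.
Qed.

Lemma l1_norm_delta s : l1_norm (l1_delta s) = w (val s).
Proof.
apply: EFin_inj; rewrite l1_normE /wsum (esumID [set s])//; last first.
  by move=> t _; rewrite lee_fin mulr_ge0// normc_ge0.
rewrite setTI esum_set1; last by rewrite lee_fin mulr_ge0// normc_ge0.
rewrite esum1 ?adde0/= /delta_fun ?eqxx ?normc1 ?mul1r// => t [_ /eqP/negPf ts].
by rewrite ts normc0 mul0r.
Qed.

Lemma l1_norm1 : l1_norm 1 = 1.
Proof. by rewrite [LHS]l1_norm_delta/= weight1. Qed.

End L1.

(* Cu_2 is the quotient of the free monoid on a_1, a_2, b_1, b_2, zero by the
   least congruence containing the defining relations; x ++ y is the product of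
   words and [::] the identity. *)
Inductive cu2_letter := La1 | La2 | Lb1 | Lb2 | Lzero.

Definition cu2_word := seq cu2_letter.

Inductive cu2_cong : cu2_word -> cu2_word -> Prop :=
| cu2_refl x : cu2_cong x x
| cu2_sym x y : cu2_cong x y -> cu2_cong y x
| cu2_trans x y z : cu2_cong x y -> cu2_cong y z -> cu2_cong x z
| cu2_cat x x' y y' :
    cu2_cong x x' -> cu2_cong y y' -> cu2_cong (x ++ y) (x' ++ y')
| cu2_a1b1 : cu2_cong [:: La1; Lb1] [::]
| cu2_a2b2 : cu2_cong [:: La2; Lb2] [::]
| cu2_a1b2 : cu2_cong [:: La1; Lb2] [:: Lzero]
| cu2_a2b1 : cu2_cong [:: La2; Lb1] [:: Lzero]
| cu2_zerol s : cu2_cong [:: Lzero; s] [:: Lzero]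
| cu2_zeror s : cu2_cong [:: s; Lzero] [:: Lzero].

HB.instance Definition _ := gen_eqMixin cu2_letter.
HB.instance Definition _ := gen_choiceMixin cu2_letter.

Definition cu2_eqb (x y : cu2_word) : bool := `[< cu2_cong x y >].

Lemma cu2_eqb_refl : reflexive cu2_eqb.
Proof. by move=> x; apply/asboolP; exact: cu2_refl. Qed.

Lemma cu2_eqb_sym : symmetric cu2_eqb.
Proof. by move=> x y; apply/asboolP/asboolP; exact: cu2_sym. Qed.

Lemma cu2_eqb_trans : transitive cu2_eqb.
Proof.
by move=> y x z /asboolP xy /asboolP yz; apply/asboolP; exact: cu2_trans yz.
Qed.

Canonical cu2_equiv :=
  EquivRel cu2_eqb cu2_eqb_refl cu2_eqb_sym cu2_eqb_trans.

Definition Cu2 := {eq_quot cu2_equiv}%qT.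
HB.instance Definition _ := Choice.on Cu2.

Definition cu2_class (x : cu2_word) : Cu2 := (\pi_{eq_quot cu2_equiv} x)%qT.

Lemma cu2_classP x y : cu2_class x = cu2_class y <-> cu2_cong x y.
Proof. by split=> [/eqmodP/asboolP|xy]; last by apply/eqmodP/asboolP. Qed.

Lemma cu2_classK (s : Cu2) : cu2_class (repr (s : {eq_quot cu2_equiv}%qT)) = s.
Proof. exact: reprK. Qed.

Definition cu2_mul (s t : Cu2) : Cu2 :=
  cu2_class (repr (s : {eq_quot cu2_equiv}%qT) ++ repr (t : {eq_quot cu2_equiv}%qT)).

Lemma cu2_mulE x y : cu2_mul (cu2_class x) (cu2_class y) = cu2_class (x ++ y).
Proof. by apply/cu2_classP/cu2_cat; apply/cu2_classP; rewrite cu2_classK. Qed.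

Lemma cu2_ind (P : Cu2 -> Prop) : (forall x, P (cu2_class x)) -> forall s, P s.
Proof. by move=> Px s; rewrite -(cu2_classK s). Qed.

Lemma cu2_mulA : associative cu2_mul.
Proof.
elim/cu2_ind => x; elim/cu2_ind => y; elim/cu2_ind => z.
by rewrite !cu2_mulE catA.
Qed.

Lemma cu2_mul1 : left_id (cu2_class [::]) cu2_mul.
Proof. by elim/cu2_ind => x; rewrite cu2_mulE. Qed.

Lemma cu2_mulr1 : right_id (cu2_class [::]) cu2_mul.
Proof. by elim/cu2_ind => x; rewrite cu2_mulE cats0. Qed.

HB.instance Definition _ := isSemigroup.Build Cu2 cu2_mulA.
HB.instance Definition _ := Semigroup_isMonoid.Build Cu2 cu2_mul1 cu2_mulr1.

Lemma cu2_mul0 (s : Cu2) : (cu2_class [:: Lzero] * s)%g = cu2_class [:: Lzero].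
Proof.
elim/cu2_ind: s => x; rewrite [LHS]cu2_mulE; apply/cu2_classP.
elim: x => [|l x IH]; first exact: cu2_refl.
apply: cu2_trans IH; rewrite -[[:: Lzero] ++ l :: x]/([:: Lzero; l] ++ x).
exact: cu2_cat (cu2_zerol l) (cu2_refl x).
Qed.

Lemma cu2_mulr0 (s : Cu2) : (s * cu2_class [:: Lzero])%g = cu2_class [:: Lzero].
Proof.
elim/cu2_ind: s => x; rewrite [LHS]cu2_mulE; apply/cu2_classP.
elim: x => [|l x IH]; first exact: cu2_refl.
apply: cu2_trans (cu2_zeror l).
exact: cu2_cat (cu2_refl [:: l]) IH.
Qed.

Definition cu2_act_letter (l : cu2_letter) (x : option (seq bool)) :=
  match l, x with
  | La1, Some (true :: s) => Some s
  | La2, Some (false :: s) => Some s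
  | Lb1, Some s => Some (true :: s)
  | Lb2, Some s => Some (false :: s)
  | _, _ => None
  end.

Definition cu2_act (x : cu2_word) (s : option (seq bool)) :=
  foldr cu2_act_letter s x.

Lemma cu2_act_cong x y : cu2_cong x y -> cu2_act x =1 cu2_act y.
Proof.
elim=> //=.
- by move=> {}x {}y _ IH s; rewrite IH.
- by move=> {}x {}y z _ IHx _ IHy s; rewrite IHx.
- by move=> {}x x' {}y y' _ IHx _ IHy s; rewrite /cu2_act !foldr_cat -!/(cu2_act _ _) IHy IHx.
- by case.
- by case.
- by case.
- by case.
- by case.
Qed.

Lemma cu2_one_neq0 : (1%g : Cu2) != cu2_class [:: Lzero].
Proof.
by apply/eqP => /cu2_classP/cu2_act_cong/(_ (Some [::])).
Qed.

HB.instance Definition _ :=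
  Monoid_hasZero.Build Cu2 cu2_mul0 cu2_mulr0 cu2_one_neq0.

Definition cu2_weight_fun (R : realType) (n : nat) (s : Cu2) : R :=
  if (s == 1%g) || (s == mzero) then 1 else n%:R.

Section Cu2Weight.
Variables (R : realType) (n : nat) (n_gt0 : (0 < n)%N).
Local Notation mu := (@cu2_weight_fun R n).

Lemma cu2_weight_ge1 s : 1 <= mu s.
Proof. by rewrite /cu2_weight_fun; case: ifP => // _; rewrite ler1n. Qed.

Lemma cu2_weight_gt0 s : 0 < mu s.
Proof. exact: lt_le_trans (cu2_weight_ge1 s). Qed.

Lemma cu2_weightM s t : mu (s * t)%g <= mu s * mu t.
Proof.
have [->|s1] := eqVneq s 1%g.
  by rewrite mul1g {2}/cu2_weight_fun eqxx mul1r.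
have [->|t1] := eqVneq t 1%g.
  by rewrite mulg1 {3}/cu2_weight_fun eqxx mulr1.
have ge1 := cu2_weight_ge1; have [->|s0] := eqVneq s mzero.
  by rewrite mul0m ler_peMr ?ge1// ltW ?cu2_weight_gt0.
have [->|t0] := eqVneq t mzero.
  by rewrite mulm0 ler_peMl ?ge1// ltW ?cu2_weight_gt0.
rewrite {2 3}/cu2_weight_fun (negPf s1) (negPf t1) (negPf s0) (negPf t0)/=.
have n1 : 1 <= n%:R :> R by rewrite ler1n.
rewrite /cu2_weight_fun; case: ifP => _; first by rewrite mulr_ege1.
by rewrite ler_peMr.
Qed.

Lemma cu2_weight1 : mu 1%g = 1.
Proof. by rewrite /cu2_weight_fun eqxx. Qed.

Definition cu2_weight : weight R Cu2 :=
  Weight cu2_weight_gt0 cu2_weightM cu2_weight1.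

End Cu2Weight.

(* The only library structure that is both a ring and a normed group is
   Num.NumDomain, so complex Banach algebras are not a join of library
   structures: they are unital algebras over R[i] with an R-valued complete
   norm. *)
Definition norm_cauchy (R : realType) (V : zmodType) (nrm : V -> R)
    (u : nat -> V) : Prop :=
  forall e, 0 < e -> exists N : nat, forall m n : nat,
    (N <= m)%N -> (N <= n)%N -> nrm (u m - u n) < e.

Definition norm_complete (R : realType) (V : zmodType) (nrm : V -> R) : Prop :=
  forall u : nat -> V, norm_cauchy nrm u ->
    exists l : V, (fun n => nrm (u n - l)) @ \oo --> (0 : R).

Record banachAlgebra (R : realType) := BanachAlgebra {
  ba_alg :> algType R[i];
  ba_norm : ba_alg -> R;
  ba_normD : forall x y, ba_norm (x + y) <= ba_norm x + ba_norm y;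
  ba_normZ : forall (c : R[i]) x, ba_norm (c *: x) = normc c * ba_norm x;
  ba_norm_eq0 : forall x, ba_norm x = 0 -> x = 0;
  ba_normM : forall x y, ba_norm (x * y) <= ba_norm x * ba_norm y;
  ba_norm1 : ba_norm 1 = 1;
  ba_complete : norm_complete ba_norm
}.

Section Cvg0.
Variable R : realType.

Lemma cvg0P (f : nat -> R) : f @ \oo --> (0 : R) <->
  forall e, 0 < e -> exists N : nat, forall n, (N <= n)%N -> `|f n| < e.
Proof.
split.
  move=> /cvgr0Pnorm_lt f0 e e0; have [N _ NP] := f0 e e0.
  by exists N => n Nn; apply: NP.
move=> f0; apply/cvgr0Pnorm_lt => e e0; have [N NP] := f0 e e0.
by exists N.
Qed.

Lemma real_cauchy_cvg (u : nat -> R) :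
  (forall e, 0 < e -> exists N : nat, forall m n : nat,
    (N <= m)%N -> (N <= n)%N -> `|u m - u n| < e) ->
  exists l : R, forall e, 0 < e ->
    exists N : nat, forall n, (N <= n)%N -> `|u n - l| < e.
Proof.
move=> uC; have /cvg_ex[l /cvgrPdist_lt ul] : cvgn u.
  apply/cauchy_cvgP/cauchy_exP => e e0; have [N NP] := uC e e0.
  by exists (u N); exists N => // n /= Nn; exact: NP.
exists l => e e0; have [N _ NP] := ul e e0.
by exists N => n Nn; rewrite distrC; apply: NP.
Qed.

Lemma complex_cauchy_cvg (z : nat -> R[i]) :
  (forall e, 0 < e -> exists N : nat, forall m n : nat,
    (N <= m)%N -> (N <= n)%N -> normc (z m - z n) < e) ->
  exists l : R[i], forall e, 0 < e ->
    exists N : nat, forall n, (N <= n)%N -> normc (z n - l) < e.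
Proof.
move=> zC.
have [|a az] := @real_cauchy_cvg (fun n => complex.Re (z n)).
  move=> e /zC[N NP]; exists N => m n Nm Nn.
  apply: le_lt_trans (NP m n Nm Nn); apply: le_trans (Re_le_normc _).
  by case: (z m) (z n) => ? ? [].
have [|b bz] := @real_cauchy_cvg (fun n => complex.Im (z n)).
  move=> e /zC[N NP]; exists N => m n Nm Nn.
  apply: le_lt_trans (NP m n Nm Nn); apply: le_trans (Im_le_normc _).
  by case: (z m) (z n) => ? ? [].
exists (a +i* b)%C => e e0.
have e2 : 0 < e / 2 by rewrite divr_gt0.
have [N1 N1P] := az _ e2; have [N2 N2P] := bz _ e2.
exists (maxn N1 N2) => n; rewrite geq_max => /andP[/N1P n1 /N2P n2].
rewrite [ltRHS]splitr; apply: le_lt_trans (ltrD n1 n2).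
case: (z n) => x y /=.
have -> : `|x - a| + `|y - b| = Num.sqrt ((`|x - a| + `|y - b|) ^+ 2).
  by rewrite sqrtr_sqr [RHS]ger0_norm ?addr_ge0.
rewrite ler_wsqrtr// [leRHS]sqrrD !real_normK ?num_real//.
by rewrite lerD2r lerDl mulrn_wge0 ?mulr_ge0.
Qed.

End Cvg0.

Section L1Complete.
Variables (R : realType) (S : zmonoidType) (w : weight R S).
Local Notation l1 := (l1 w).

Lemma l1_complete : norm_complete (@l1_norm R S w).
Proof.
move=> u uC.
have w_gt0 s : 0 < w s by exact: weight_gt0.
have /choice[L LP] : forall s, exists l : R[i], forall e, 0 < e ->
    exists N : nat, forall n, (N <= n)%N -> normc (u n s - l) < e.
  move=> s; apply: complex_cauchy_cvg => e e0.
  have [N NP] := uC (e * w (val s)) (mulr_gt0 e0 (w_gt0 _)).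
  exists N => m n Nm Nn.
  rewrite -(ltr_pM2r (w_gt0 (val s))); apply: le_lt_trans (NP m n Nm Nn).
  exact: (l1_norm_coef (u m - u n) s).
have key e N : 0 < e -> (forall m n, (N <= m)%N -> (N <= n)%N -> l1_norm (u m - u n) < e) ->
    forall n, (N <= n)%N -> (wsum w (fun s => normc (u n s - L s)%R) <= e%:E)%E.
  move=> e0 NP n Nn; apply: ge_ereal_sup => _ [X [finX _] <-].
  rewrite fsbig_finite//= sumEFin lee_fin.
  set r := finmap.enum_fset (fset_set X).
  apply/ler_addgt0Pr => d d0.
  have [M MP] : exists M : nat, forall m, (M <= m)%N ->
      \sum_(s <- r) normc (u m s - L s) * w (val s) < d.
    elim: r d d0 => [|s s' IH] d d0.
      by exists 0%N => m _; rewrite big_nil.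
    have d2 : 0 < d / 2 by rewrite divr_gt0.
    have [M1 M1P] := IH _ d2.
    have [M2 M2P] := LP s (d / 2 / w (val s)) (divr_gt0 d2 (w_gt0 _)).
    exists (maxn M1 M2) => m; rewrite geq_max => /andP[/M1P m1 /M2P m2].
    rewrite big_cons [ltRHS]splitr; apply: ltrD m1.
    by rewrite -ltr_pdivlMr.
  pose m := maxn N M.
  have Nm : (N <= m)%N by rewrite leq_maxl.
  have /MP/ltW md : (M <= m)%N by rewrite leq_maxr.
  have /ltW nm := NP n m Nn Nm.
  apply: le_trans (lerD nm md).
  apply: (@le_trans _ _ (\sum_(s <- r) normc (u n s - u m s) * w (val s) +
                         \sum_(s <- r) normc (u m s - L s) * w (val s))).
    rewrite -big_split/=; apply: ler_sum => s _.
    rewrite -mulrDl ler_wpM2r ?(ltW (w_gt0 _))//.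
    have := ler_normcD (u n s - u m s) (u m s - L s).
    by rewrite addrA subrK.
  rewrite lerD2r -lee_fin l1_normE -sumEFin.
  apply: ereal_sup_ubound; exists X; first by split.
  by rewrite fsbig_finite.
have Ll : l1_pred w L.
  have [N NP] := uC 1 ltr01.
  have /= uN := key 1 N ltr01 NP N (leqnn N).
  have fN := l1P (u N).
  have := lte_add_pinfty (le_lt_trans uN (ltry 1)) fN.
  rewrite -wsumD; try by move=> s; exact: normc_ge0.
  apply: le_lt_trans; apply: le_wsum => s.
  rewrite -[normc (u N s - L s)]normcN opprB.
  have := ler_normcD (L s - u N s) (u N s).
  by rewrite subrK.
exists (L1 Ll); apply/cvg0P => e e0.
have e2 : 0 < e / 2 by rewrite divr_gt0.
have [N NP] := uC _ e2.
exists N => n Nn.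
have := key _ _ e2 NP n Nn.
rewrite -(l1_normE (u n - L1 Ll)) lee_fin => ne.
have n0 : 0 <= l1_norm (u n - L1 Ll).
  by rewrite fine_ge0// wsum_ge0// => s; exact: normc_ge0.
rewrite ger0_norm//; apply: le_lt_trans ne _.
by rewrite ltr_pdivrMr// ltr_pMr// ltr1n.
Qed.

Definition l1_banach : banachAlgebra R :=
  BanachAlgebra (@l1_normD R S w) (@l1_normZ R S w) (@l1_norm_eq0 R S w)
    (@l1_normM R S w) (@l1_norm1 R S w) l1_complete.

End L1Complete.

Section BanachTheory.
Variables (R : realType) (A : banachAlgebra R).
Implicit Types x y : A.
Local Notation N := (@ba_norm R A).

Lemma ba_norm0 : N 0 = 0.
Proof. by rewrite -(scale0r 0) ba_normZ normc0 mul0r. Qed.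

Lemma ba_normN x : N (- x) = N x.
Proof. by rewrite -scaleN1r ba_normZ normcN normc1 mul1r. Qed.

Lemma ba_norm_ge0 x : 0 <= N x.
Proof.
have := ba_normD x (- x); rewrite subrr ba_norm0 ba_normN -mulr2n.
by rewrite pmulrn_lge0.
Qed.

Lemma ba_distC x y : N (x - y) = N (y - x).
Proof. by rewrite -ba_normN opprB. Qed.

Lemma ba_dist_triangle z x y : N (x - y) <= N (x - z) + N (z - y).
Proof. by apply: le_trans (ba_normD _ _); rewrite addrA subrK. Qed.

Lemma ba_norm_lim_le (u : nat -> A) l x e :
  (fun n => N (u n - l)) @ \oo --> (0 : R) ->
  (exists M : nat, forall n, (M <= n)%N -> N (x - u n) <= e) -> N (x - l) <= e.
Proof.
move=> /cvg0P ul [M MP]; apply/ler_addgt0Pr => d /ul[K KP].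
have /MP xu : (M <= maxn M K)%N by rewrite leq_maxl.
have /KP ud : (K <= maxn M K)%N by rewrite leq_maxr.
apply: le_trans (ba_dist_triangle (u (maxn M K)) _ _) _.
by apply: lerD => //; apply: le_trans (ler_norm _) (ltW ud).
Qed.

End BanachTheory.

Section Linf.
Variables (R : realType) (A : nat -> banachAlgebra R).

Definition linf_pred (a : forall n, A n) : bool :=
  `[< exists M : R, forall n, ba_norm (a n) <= M >].

Record linf := Linf { linf_val :> forall n, A n; _ : linf_pred linf_val }.
HB.instance Definition _ := [isSub for linf_val].
HB.instance Definition _ := [Choice of linf by <:].

Lemma linfP (a : linf) : exists M : R, forall n, ba_norm (a n) <= M.
Proof. by apply/asboolP; exact: (valP a). Qed.

Lemma linf_eq (a b : linf) : (forall n, a n = b n) -> a = b.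
Proof. by move=> ab; apply: val_inj; apply: functional_extensionality_dep. Qed.

Lemma linf_zero_subproof : linf_pred (fun=> 0).
Proof. by apply/asboolP; exists 0 => n; rewrite ba_norm0. Qed.

Lemma linf_opp_subproof (a : linf) : linf_pred (fun n => - a n).
Proof.
have [M aM] := linfP a; apply/asboolP; exists M => n.
by rewrite ba_normN.
Qed.

Lemma linf_add_subproof (a b : linf) : linf_pred (fun n => a n + b n).
Proof.
have [M aM] := linfP a; have [K bK] := linfP b; apply/asboolP; exists (M + K) => n.
exact: le_trans (ba_normD _ _) (lerD (aM n) (bK n)).
Qed.

Lemma linf_one_subproof : linf_pred (fun=> 1).
Proof. by apply/asboolP; exists 1 => n; rewrite ba_norm1. Qed.

Lemma linf_mul_subproof (a b : linf) : linf_pred (fun n => a n * b n).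
Proof.
have [M aM] := linfP a; have [K bK] := linfP b; apply/asboolP; exists (M * K) => n.
apply: le_trans (ba_normM _ _) _.
by apply: ler_pM (aM n) (bK n); exact: ba_norm_ge0.
Qed.

Lemma linf_scale_subproof (c : R[i]) (a : linf) : linf_pred (fun n => c *: a n).
Proof.
have [M aM] := linfP a; apply/asboolP; exists (normc c * M) => n.
by rewrite ba_normZ ler_wpM2l ?normc_ge0.
Qed.

Definition linf_zero := Linf linf_zero_subproof.
Definition linf_opp a := Linf (linf_opp_subproof a).
Definition linf_add a b := Linf (linf_add_subproof a b).
Definition linf_one := Linf linf_one_subproof.
Definition linf_mul a b := Linf (linf_mul_subproof a b).
Definition linf_scale c a := Linf (linf_scale_subproof c a).

Lemma linf_addA : associative linf_add.
Proof. by move=> a b c; apply: linf_eq => n /=; rewrite addrA. Qed.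
Lemma linf_addC : commutative linf_add.
Proof. by move=> a b; apply: linf_eq => n /=; rewrite addrC. Qed.
Lemma linf_add0 : left_id linf_zero linf_add.
Proof. by move=> a; apply: linf_eq => n /=; rewrite add0r. Qed.
Lemma linf_addN : left_inverse linf_zero linf_opp linf_add.
Proof. by move=> a; apply: linf_eq => n /=; rewrite addNr. Qed.

HB.instance Definition _ :=
  GRing.isZmodule.Build linf linf_addA linf_addC linf_add0 linf_addN.

Lemma linf_mulA : associative linf_mul.
Proof. by move=> a b c; apply: linf_eq => n /=; rewrite mulrA. Qed.
Lemma linf_mul1 : left_id linf_one linf_mul.
Proof. by move=> a; apply: linf_eq => n /=; rewrite mul1r. Qed.
Lemma linf_mulr1 : right_id linf_one linf_mul.
Proof. by move=> a; apply: linf_eq => n /=; rewrite mulr1. Qed.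
Lemma linf_mulDl : left_distributive linf_mul +%R.
Proof. by move=> a b c; apply: linf_eq => n /=; rewrite mulrDl. Qed.
Lemma linf_mulDr : right_distributive linf_mul +%R.
Proof. by move=> a b c; apply: linf_eq => n /=; rewrite mulrDr. Qed.
Lemma linf_one_neq0 : linf_one != 0.
Proof.
by apply/eqP => /(congr1 (fun a : linf => a 0%N)) /eqP; rewrite /= oner_eq0.
Qed.

HB.instance Definition _ := GRing.Zmodule_isNzRing.Build linf
  linf_mulA linf_mul1 linf_mulr1 linf_mulDl linf_mulDr linf_one_neq0.

Lemma linf_scaleA c d a : linf_scale c (linf_scale d a) = linf_scale (c * d) a.
Proof. by apply: linf_eq => n /=; rewrite scalerA. Qed.
Lemma linf_scale1 : left_id 1 linf_scale.
Proof. by move=> a; apply: linf_eq => n /=; rewrite scale1r. Qed.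
Lemma linf_scaleDr : right_distributive linf_scale +%R.
Proof. by move=> c a b; apply: linf_eq => n /=; rewrite scalerDr. Qed.
Lemma linf_scaleDl a : {morph linf_scale^~ a : c d / c + d}.
Proof. by move=> c d; apply: linf_eq => n /=; rewrite scalerDl. Qed.

HB.instance Definition _ := GRing.Zmodule_isLmodule.Build R[i] linf
  linf_scaleA linf_scale1 linf_scaleDr linf_scaleDl.

Lemma linf_scaleAl (c : R[i]) (a b : linf) : c *: (a * b) = (c *: a) * b.
Proof. by apply: linf_eq => n /=; rewrite -scalerAl. Qed.
Lemma linf_scaleAr (c : R[i]) (a b : linf) : c *: (a * b) = a * (c *: b).
Proof. by apply: linf_eq => n /=; rewrite -scalerAr. Qed.

HB.instance Definition _ := GRing.Lmodule_isLalgebra.Build R[i] linf linf_scaleAl.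
HB.instance Definition _ := GRing.Lalgebra_isAlgebra.Build R[i] linf linf_scaleAr.

Definition linf_norm (a : linf) : R := sup (range (fun n => ba_norm (a n))).

Lemma linf_norm_coef (a : linf) n : ba_norm (a n) <= linf_norm a.
Proof.
apply: sup_upper_bound; last by exists n.
split; first by exists (ba_norm (a 0%N)), 0%N.
by have [M aM] := linfP a; exists M => _ [k _ <-].
Qed.

Lemma linf_norm_le (a : linf) M : (forall n, ba_norm (a n) <= M) -> linf_norm a <= M.
Proof.
move=> aM; apply: ge_sup; first by exists (ba_norm (a 0%N)), 0%N.
by move=> _ [k _ <-].
Qed.

Lemma linf_norm_ge0 (a : linf) : 0 <= linf_norm a.
Proof. exact: le_trans (ba_norm_ge0 _) (linf_norm_coef a 0%N). Qed.

Lemma linf_normD (a b : linf) : linf_norm (a + b) <= linf_norm a + linf_norm b.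
Proof.
apply: linf_norm_le => n; apply: le_trans (ba_normD _ _) _.
by apply: lerD; exact: linf_norm_coef.
Qed.

Lemma linf_normZ_le (c : R[i]) (a : linf) : linf_norm (c *: a) <= normc c * linf_norm a.
Proof.
apply: linf_norm_le => n; rewrite ba_normZ ler_wpM2l ?normc_ge0//.
exact: linf_norm_coef.
Qed.

Lemma linf_normZ (c : R[i]) (a : linf) : linf_norm (c *: a) = normc c * linf_norm a.
Proof.
apply/eqP; rewrite eq_le linf_normZ_le/=.
have [->|c0] := eqVneq c 0; first by rewrite normc0 mul0r linf_norm_ge0.
have nc0 : 0 < normc c.
  rewrite lt_neqAle normc_ge0 andbT eq_sym; apply: contra c0 => /eqP.
  by move=> /eq0_normc ->.
rewrite -ler_pdivlMl// -normcV.
by have := linf_normZ_le c^-1 (c *: a); rewrite scalerA mulVf// scale1r.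
Qed.

Lemma linf_norm_eq0 (a : linf) : linf_norm a = 0 -> a = 0.
Proof.
move=> a0; apply: linf_eq => n; apply: ba_norm_eq0; apply: le_anti.
by rewrite ba_norm_ge0 andbT -a0 linf_norm_coef.
Qed.

Lemma linf_normM (a b : linf) : linf_norm (a * b) <= linf_norm a * linf_norm b.
Proof.
apply: linf_norm_le => n; apply: le_trans (ba_normM _ _) _.
by apply: ler_pM; rewrite ?ba_norm_ge0// linf_norm_coef.
Qed.

Lemma linf_norm1 : linf_norm 1 = 1.
Proof.
apply/eqP; rewrite eq_le linf_norm_le/=; last by move=> n; rewrite ba_norm1.
by rewrite -{1}(@ba_norm1 _ (A 0%N)) (linf_norm_coef 1 0%N).
Qed.

Lemma linf_complete : norm_complete linf_norm.
Proof.
move=> u uC.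
have coef m k n : ba_norm (u m n - u k n) <= linf_norm (u m - u k).
  exact: (linf_norm_coef (u m - u k) n).
have uCn n : norm_cauchy (@ba_norm R (A n)) (fun m => u m n).
  move=> e /uC[N NP]; exists N => m k Nm Nk.
  exact: le_lt_trans (coef m k n) (NP m k Nm Nk).
have L n : {l : A n | (fun m => ba_norm (u m n - l)) @ \oo --> (0 : R)}.
  by apply: cid; exact: ba_complete (uCn n).
pose l n := sval (L n).
have key e N : (forall m k, (N <= m)%N -> (N <= k)%N -> linf_norm (u m - u k) < e) ->
    forall m, (N <= m)%N -> forall n, ba_norm (u m n - l n) <= e.
  move=> NP m Nm n; apply: ba_norm_lim_le (svalP (L n)) _.
  exists N => k Nk; apply: le_trans (coef m k n) _.
  exact/ltW/NP.
have ll : linf_pred l.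
  apply/asboolP; have [N NP] := uC 1 ltr01.
  exists (1 + linf_norm (u N)) => n.
  rewrite -(subrK (u N n) (l n)); apply: le_trans (ba_normD _ _) _.
  by rewrite ba_distC lerD ?linf_norm_coef// (key 1 N).
exists (Linf ll); apply/cvg0P => e e0.
have e2 : 0 < e / 2 by rewrite divr_gt0.
have [N NP] := uC _ e2.
exists N => m Nm; rewrite ger0_norm ?linf_norm_ge0//.
apply: (@le_lt_trans _ _ (e / 2)); last by rewrite ltr_pdivrMr// ltr_pMr// ltr1n.
by apply: linf_norm_le => n; exact: key Nm n.
Qed.

Definition linf_banach : banachAlgebra R :=
  BanachAlgebra linf_normD linf_normZ linf_norm_eq0 linf_normM linf_norm1
    linf_complete.

Definition c0 (a : linf) : Prop := (fun n => ba_norm (a n)) @ \oo --> (0 : R).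

Lemma c0P a : c0 a <-> forall e, 0 < e ->
  exists N : nat, forall n, (N <= n)%N -> ba_norm (a n) < e.
Proof.
split=> [/cvg0P|] H; first by move=> e /H[N NP]; exists N => n /NP; rewrite ger0_norm ?ba_norm_ge0.
by apply/cvg0P => e /H[N NP]; exists N => n /NP; rewrite ger0_norm ?ba_norm_ge0.
Qed.

Lemma c0_0 : c0 0.
Proof. by apply/c0P => e e0; exists 0%N => n _ /=; rewrite ba_norm0. Qed.

Lemma c0Z c a : c0 a -> c0 (c *: a).
Proof.
move=> /c0P a0; apply/c0P => e e0.
have c1 : 0 < normc c + 1 by rewrite ltr_wpDl ?normc_ge0.
have [N NP] := a0 (e / (normc c + 1)) (divr_gt0 e0 c1).
exists N => n /NP an; rewrite ba_normZ; apply: (@le_lt_trans _ _ ((normc c + 1) * ba_norm (a n))).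
  by rewrite ler_wpM2r ?ba_norm_ge0// lerDl.
by rewrite -ltr_pdivlMl// mulrC.
Qed.

Lemma c0N a : c0 a -> c0 (- a).
Proof. by move=> a0; rewrite -scaleN1r; exact: c0Z. Qed.

Lemma c0D a b : c0 a -> c0 b -> c0 (a + b).
Proof.
move=> /c0P a0 /c0P b0; apply/c0P => e e0.
have e2 : 0 < e / 2 by rewrite divr_gt0.
have [N NP] := a0 _ e2; have [M MP] := b0 _ e2.
exists (maxn N M) => n; rewrite geq_max => /andP[/NP an /MP bn].
by rewrite [ltRHS]splitr; apply: le_lt_trans (ba_normD _ _) (ltrD an bn).
Qed.

Lemma c0Mr a b : c0 a -> c0 (a * b).
Proof.
move=> /c0P a0; apply/c0P => e e0.
have b1 : 0 < linf_norm b + 1 by rewrite ltr_wpDl ?linf_norm_ge0.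
have [N NP] := a0 _ (divr_gt0 e0 b1).
exists N => n /NP an; apply: le_lt_trans (ba_normM _ _) _.
apply: (@le_lt_trans _ _ (ba_norm (a n) * (linf_norm b + 1))).
  rewrite ler_wpM2l ?ba_norm_ge0//; apply: le_trans (linf_norm_coef b n) _.
  by rewrite lerDl.
by rewrite -ltr_pdivlMr.
Qed.

Lemma c0Ml a b : c0 b -> c0 (a * b).
Proof.
move=> /c0P b0; apply/c0P => e e0.
have a1 : 0 < linf_norm a + 1 by rewrite ltr_wpDl ?linf_norm_ge0.
have [N NP] := b0 _ (divr_gt0 e0 a1).
exists N => n /NP bn; apply: le_lt_trans (ba_normM _ _) _.
apply: (@le_lt_trans _ _ ((linf_norm a + 1) * ba_norm (b n))).
  rewrite ler_wpM2r ?ba_norm_ge0//; apply: le_trans (linf_norm_coef a n) _.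
  by rewrite lerDl.
by rewrite -ltr_pdivlMl// mulrC.
Qed.

Lemma c0_one : ~ c0 1.
Proof.
by move=> /c0P/(_ 1 ltr01)[N /(_ N (leqnn N))]; rewrite /= ba_norm1 ltxx.
Qed.

(* Asy is the quotient of linf by c0, which c0D, c0Z, c0Ml and c0Mr show to be a
   two-sided ideal. *)
Definition asy_rel (a b : linf) : bool := `[< c0 (a - b) >].

Lemma asy_rel_refl : reflexive asy_rel.
Proof. by move=> a; apply/asboolP; rewrite subrr; exact: c0_0. Qed.

Lemma asy_rel_sym : symmetric asy_rel.
Proof. by move=> a b; apply/asboolP/asboolP => /c0N; rewrite opprB. Qed.

Lemma asy_rel_trans : transitive asy_rel.
Proof.
move=> b a c /asboolP ab /asboolP bc; apply/asboolP.
by have := c0D ab bc; rewrite addrA subrK.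
Qed.

Canonical asy_equiv := EquivRel asy_rel asy_rel_refl asy_rel_sym asy_rel_trans.

Definition asy := {eq_quot asy_equiv}%qT.
HB.instance Definition _ := Choice.on asy.

Definition asy_class (a : linf) : asy := (\pi_{eq_quot asy_equiv} a)%qT.
Definition asy_repr (x : asy) : linf := repr (x : {eq_quot asy_equiv}%qT).

Lemma asy_classP a b : asy_class a = asy_class b <-> c0 (a - b).
Proof. by split=> [/eqmodP/asboolP|ab]; last by apply/eqmodP/asboolP. Qed.

Lemma asy_reprK x : asy_class (asy_repr x) = x.
Proof. exact: reprK. Qed.

Lemma asy_ind (P : asy -> Prop) : (forall a, P (asy_class a)) -> forall x, P x.
Proof. by move=> Pa x; rewrite -(asy_reprK x). Qed.

Lemma asy_repr_c0 a : c0 (asy_repr (asy_class a) - a).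
Proof. by apply/asy_classP; rewrite asy_reprK. Qed.

Definition asy_opp x := asy_class (- asy_repr x).
Definition asy_add x y := asy_class (asy_repr x + asy_repr y).
Definition asy_mul x y := asy_class (asy_repr x * asy_repr y).
Definition asy_scale c x := asy_class (c *: asy_repr x).

Lemma asy_oppE a : asy_opp (asy_class a) = asy_class (- a).
Proof. by apply/asy_classP; rewrite -opprD; exact/c0N/asy_repr_c0. Qed.

Lemma asy_addE a b : asy_add (asy_class a) (asy_class b) = asy_class (a + b).
Proof. by apply/asy_classP; rewrite opprD addrACA; apply: c0D; exact: asy_repr_c0. Qed.

Lemma asy_mulE a b : asy_mul (asy_class a) (asy_class b) = asy_class (a * b).
Proof.
apply/asy_classP; set a' := asy_repr _; set b' := asy_repr _.
have -> : a' * b' - a * b = (a' - a) * b' + a * (b' - b).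
  by rewrite mulrBl mulrBr addrA subrK.
by apply: c0D; [apply: c0Mr|apply: c0Ml]; exact: asy_repr_c0.
Qed.

Lemma asy_scaleE c a : asy_scale c (asy_class a) = asy_class (c *: a).
Proof. by apply/asy_classP; rewrite -scalerBr; exact/c0Z/asy_repr_c0. Qed.

Lemma asy_addA : associative asy_add.
Proof.
elim/asy_ind => a; elim/asy_ind => b; elim/asy_ind => c.
by rewrite !asy_addE addrA.
Qed.
Lemma asy_addC : commutative asy_add.
Proof. by elim/asy_ind => a; elim/asy_ind => b; rewrite !asy_addE addrC. Qed.
Lemma asy_add0 : left_id (asy_class 0) asy_add.
Proof. by elim/asy_ind => a; rewrite asy_addE add0r. Qed.
Lemma asy_addN : left_inverse (asy_class 0) asy_opp asy_add.
Proof. by elim/asy_ind => a; rewrite asy_oppE asy_addE addNr. Qed.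

HB.instance Definition _ :=
  GRing.isZmodule.Build asy asy_addA asy_addC asy_add0 asy_addN.

Lemma asy_classD a b : asy_class (a + b) = asy_class a + asy_class b.
Proof. by rewrite [RHS]asy_addE. Qed.

Lemma asy_mulA : associative asy_mul.
Proof.
elim/asy_ind => a; elim/asy_ind => b; elim/asy_ind => c.
by rewrite !asy_mulE mulrA.
Qed.
Lemma asy_mul1 : left_id (asy_class 1) asy_mul.
Proof. by elim/asy_ind => a; rewrite asy_mulE mul1r. Qed.
Lemma asy_mulr1 : right_id (asy_class 1) asy_mul.
Proof. by elim/asy_ind => a; rewrite asy_mulE mulr1. Qed.
Lemma asy_mulDl : left_distributive asy_mul +%R.
Proof.
elim/asy_ind => a; elim/asy_ind => b; elim/asy_ind => c.
by rewrite -asy_classD !asy_mulE -asy_classD mulrDl.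
Qed.
Lemma asy_mulDr : right_distributive asy_mul +%R.
Proof.
elim/asy_ind => a; elim/asy_ind => b; elim/asy_ind => c.
by rewrite -asy_classD !asy_mulE -asy_classD mulrDr.
Qed.
Lemma asy_one_neq0 : asy_class 1 != 0.
Proof. by apply/eqP => /asy_classP; rewrite subr0; exact: c0_one. Qed.

HB.instance Definition _ := GRing.Zmodule_isNzRing.Build asy
  asy_mulA asy_mul1 asy_mulr1 asy_mulDl asy_mulDr asy_one_neq0.

Lemma asy_scaleA c d x : asy_scale c (asy_scale d x) = asy_scale (c * d) x.
Proof. by elim/asy_ind: x => a; rewrite !asy_scaleE scalerA. Qed.
Lemma asy_scale1 : left_id 1 asy_scale.
Proof. by elim/asy_ind => a; rewrite asy_scaleE scale1r. Qed.
Lemma asy_scaleDr : right_distributive asy_scale +%R.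
Proof.
move=> c; elim/asy_ind => a; elim/asy_ind => b.
by rewrite -asy_classD !asy_scaleE -asy_classD scalerDr.
Qed.
Lemma asy_scaleDl x : {morph asy_scale^~ x : c d / c + d}.
Proof.
by elim/asy_ind: x => a c d; rewrite !asy_scaleE -asy_classD scalerDl.
Qed.

HB.instance Definition _ := GRing.Zmodule_isLmodule.Build R[i] asy
  asy_scaleA asy_scale1 asy_scaleDr asy_scaleDl.

Lemma asy_classM a b : asy_class (a * b) = asy_class a * asy_class b.
Proof. by rewrite [RHS]asy_mulE. Qed.

Lemma asy_classZ c a : asy_class (c *: a) = c *: asy_class a.
Proof. by rewrite [RHS]asy_scaleE. Qed.

Lemma asy_classB a b : asy_class (a - b) = asy_class a - asy_class b.
Proof. by rewrite asy_classD -[- b]scaleN1r asy_classZ scaleN1r. Qed.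

Lemma asy_scaleAl (c : R[i]) (x y : asy) : c *: (x * y) = (c *: x) * y.
Proof.
elim/asy_ind: x => a; elim/asy_ind: y => b.
by rewrite -(asy_classM a b) -!asy_classZ -(asy_classM (c *: a) b) scalerAl.
Qed.
Lemma asy_scaleAr (c : R[i]) (x y : asy) : c *: (x * y) = x * (c *: y).
Proof.
elim/asy_ind: x => a; elim/asy_ind: y => b.
by rewrite -(asy_classM a b) -!asy_classZ -(asy_classM a (c *: b)) scalerAr.
Qed.

HB.instance Definition _ := GRing.Lmodule_isLalgebra.Build R[i] asy asy_scaleAl.
HB.instance Definition _ := GRing.Lalgebra_isAlgebra.Build R[i] asy asy_scaleAr.

Definition asy_norm (x : asy) : R :=
  inf [set linf_norm a | a in [set a | asy_class a = x]].

Lemma asy_norm_has_inf x :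
  has_inf [set linf_norm a | a in [set a | asy_class a = x]].
Proof.
split; first by exists (linf_norm (asy_repr x)), (asy_repr x) => //; exact: asy_reprK.
by exists 0 => _ [a _ <-]; exact: linf_norm_ge0.
Qed.

Lemma asy_norm_class a : asy_norm (asy_class a) <= linf_norm a.
Proof.
apply: ge_inf; last by exists a.
exact: (asy_norm_has_inf _).2.
Qed.

Lemma asy_norm_lt x e : asy_norm x < e -> exists2 a, asy_class a = x & linf_norm a < e.
Proof.
rewrite -subr_gt0 => xe.
have [_ [a ax <-]] := inf_adherent xe (asy_norm_has_inf x).
by rewrite -/(asy_norm x) addrC subrK => ae; exists a.
Qed.

Lemma le_asy_norm x m k : 0 <= k ->
  (forall a, asy_class a = x -> m <= linf_norm a * k) -> m <= asy_norm x * k.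
Proof.
move=> k0 H; move: k0; rewrite le_eqVlt => /orP[/eqP k0|k0].
  by have := H _ (asy_reprK x); rewrite -k0 !mulr0.
rewrite -ler_pdivrMr//; apply: lb_le_inf; first exact: (asy_norm_has_inf x).1.
by move=> _ [a /= /H am <-]; rewrite ler_pdivrMr.
Qed.

Lemma asy_norm_ge0 x : 0 <= asy_norm x.
Proof.
by rewrite -[leRHS]mulr1; apply: le_asy_norm => // a _; rewrite mulr1 linf_norm_ge0.
Qed.

Lemma asy_normD x y : asy_norm (x + y) <= asy_norm x + asy_norm y.
Proof.
rewrite -lerBlDr -[leRHS]mulr1; apply: le_asy_norm => // a ax.
rewrite mulr1 lerBlDl -lerBlDr -[leRHS]mulr1; apply: le_asy_norm => // b bx.
rewrite mulr1 lerBlDr [leRHS]addrC -ax -bx -asy_classD.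
exact: le_trans (asy_norm_class _) (linf_normD _ _).
Qed.

Lemma asy_normM x y : asy_norm (x * y) <= asy_norm x * asy_norm y.
Proof.
apply: le_asy_norm; first exact: asy_norm_ge0.
move=> a ax; rewrite mulrC; apply: le_asy_norm; first exact: linf_norm_ge0.
move=> b bx; rewrite -ax -bx -asy_classM mulrC.
exact: le_trans (asy_norm_class _) (linf_normM a b).
Qed.

Lemma asy_normZ_le c x : asy_norm (c *: x) <= normc c * asy_norm x.
Proof.
rewrite mulrC; apply: le_asy_norm; first exact: normc_ge0.
move=> a <-; rewrite -asy_classZ mulrC.
by apply: le_trans (asy_norm_class _) _; rewrite linf_normZ.
Qed.

Lemma asy_normZ c x : asy_norm (c *: x) = normc c * asy_norm x.
Proof.
apply/eqP; rewrite eq_le asy_normZ_le/=.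
have [->|c0] := eqVneq c 0; first by rewrite normc0 mul0r asy_norm_ge0.
have nc0 : 0 < normc c.
  rewrite lt_neqAle normc_ge0 andbT eq_sym; apply: contra c0 => /eqP.
  by move=> /eq0_normc ->.
rewrite -ler_pdivlMl// -normcV.
by have := asy_normZ_le c^-1 (c *: x); rewrite scalerA mulVf// scale1r.
Qed.

Lemma asy_norm_eq0 x : asy_norm x = 0 -> x = 0.
Proof.
elim/asy_ind: x => a a0; apply/asy_classP; rewrite subr0.
apply/c0P => e e0; have e2 : 0 < e / 2 by rewrite divr_gt0.
have [b ba be] : exists2 b, asy_class b = asy_class a & linf_norm b < e / 2.
  by apply: asy_norm_lt; rewrite a0.
have /asy_classP/c0P/(_ _ e2)[N NP] := esym ba.
exists N => n /NP abn; rewrite -(subrK (b n) (a n)) [ltRHS]splitr.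
apply: le_lt_trans (ba_normD _ _) _; apply: ltrD abn _.
exact: le_lt_trans (linf_norm_coef b n) be.
Qed.

Lemma asy_norm1 : asy_norm 1 = 1.
Proof.
apply/eqP; rewrite eq_le; apply/andP; split.
  by rewrite -linf_norm1; exact: asy_norm_class.
have n0 : 0 < asy_norm 1.
  rewrite lt_neqAle asy_norm_ge0 andbT eq_sym; apply/eqP => /asy_norm_eq0/eqP.
  by rewrite oner_eq0.
by have := asy_normM 1 1; rewrite mulr1 ler_pMr.
Qed.

Lemma asy_complete : norm_complete asy_norm.
Proof.
move=> u uC.
have half_gt0 k : 0 < (2^-1 : R) ^+ k by rewrite exprn_gt0// invr_gt0.
have /choice[N0 N0P] k := uC _ (half_gt0 k).
pose N k := (k + \sum_(j < k.+1) N0 j)%N.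
have N0N k : (N0 k <= N k)%N by rewrite /N big_ord_recr/= addnA leq_addl.
have NS k : (N k <= N k.+1)%N by rewrite /N [in leqRHS]big_ord_recr/= leq_add// leq_addr.
have /choice[d dP] k : exists d, asy_class d = u (N k.+1) - u (N k) /\
    linf_norm d < 2^-1 ^+ k.
  have [|d dE dn] := @asy_norm_lt (u (N k.+1) - u (N k)) (2^-1 ^+ k).
    by apply: N0P; [exact: leq_trans (N0N k) (NS k)|exact: N0N].
  by exists d.
pose y k := asy_repr (u (N 0%N)) + \sum_(j < k) d j.
have ySE k : y k.+1 = y k + d k by rewrite /y big_ord_recr addrA.
have yE k : asy_class (y k) = u (N k).
  elim: k => [|k IH]; first by rewrite /y big_ord0 addr0 asy_reprK.
  rewrite ySE asy_classD IH (dP k).1.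
  by rewrite addrC subrK.
have ydist k m : linf_norm (y (k + m)%N - y k) <= 2 * 2^-1 ^+ k - 2 * 2^-1 ^+ (k + m)%N.
  elim: m => [|m IH].
    by rewrite addn0 !subrr; apply: linf_norm_le => n; rewrite /= ba_norm0.
  have -> : y (k + m.+1)%N - y k = d (k + m)%N + (y (k + m)%N - y k).
    by rewrite addnS ySE [RHS]addrA [d _ + _]addrC.
  apply: le_trans (linf_normD _ _) _.
  apply: le_trans (lerD (ltW (dP _).2) IH) _.
  rewrite addnS exprS mulrA divff ?pnatr_eq0// mul1r addrC -addrA lerD2l.
  by rewrite mulr_natl mulr2n opprD subrK.
have half_lt e : 0 < e -> exists k, 2 * (2^-1 : R) ^+ k < e.
  move=> e0; have e2 : 0 < e / 2 by rewrite divr_gt0.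
  have h1 : `|2^-1 : R| < 1 by rewrite ger0_norm ?invr_ge0// invf_lt1// ltr1n.
  have /cvg0P/(_ _ e2)[K KP] := cvg_expr h1.
  exists K; have := KP K (leqnn K); rewrite (ger0_norm (ltW (half_gt0 K))) => hK.
  by rewrite mulrC -ltr_pdivlMr.
have yC : norm_cauchy linf_norm y.
  move=> e e0; have e2 : 0 < e / 2 by rewrite divr_gt0.
  have [K KP] := half_lt _ e2; exists K.
  have yK m : (K <= m)%N -> linf_norm (y m - y K) < e / 2.
    move=> Km; have := ydist K (m - K)%N; rewrite subnKC// => /le_lt_trans; apply.
    apply: le_lt_trans KP; rewrite gerBl.
    by rewrite mulr_ge0// ltW// half_gt0.
  move=> m n Km Kn; rewrite [ltRHS]splitr.
  apply: le_lt_trans (@ba_dist_triangle _ linf_banach (y K) (y m) (y n)) _.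
  by apply: ltrD; [exact: yK|rewrite ba_distC; exact: yK].
have [l /cvg0P ly] := linf_complete yC.
exists (asy_class l); apply/cvg0P => e e0.
have e2 : 0 < e / 2 by rewrite divr_gt0.
have [M MP] := uC _ e2; have [K KP] := ly _ e2.
have [k Kk Mk] : exists2 k, (K <= k)%N & (M <= N k)%N.
  exists (maxn K M); first exact: leq_maxl.
  by apply: leq_trans (leq_maxr K M) _; rewrite /N leq_addr.
exists M => n Mn; rewrite ger0_norm ?asy_norm_ge0//.
rewrite -(subrK (u (N k)) (u n)) -addrA [ltRHS]splitr.
apply: le_lt_trans (asy_normD _ _) _; apply: ltrD; first exact: MP.
rewrite -yE -asy_classB; apply: le_lt_trans (asy_norm_class _) _.
by apply: le_lt_trans (KP k Kk); exact: ler_norm.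
Qed.

Definition Asy : banachAlgebra R :=
  BanachAlgebra asy_normD asy_normZ asy_norm_eq0 asy_normM asy_norm1
    asy_complete.

End Linf.

Definition idempotent_elt (A : pzRingType) (p : A) : Prop := p * p = p.

Definition idempotent_equiv (A : pzRingType) (p q : A) : Prop :=
  exists a b : A, p = a * b /\ q = b * a.

Definition orthogonal_elts (A : pzRingType) (p q : A) : Prop :=
  p * q = 0 /\ q * p = 0.

Definition properly_infinite (A : pzRingType) : Prop :=
  exists p q : A,
    [/\ idempotent_elt p, idempotent_elt q, orthogonal_elts p q,
        idempotent_equiv p 1 & idempotent_equiv q 1].

(* Main.v *)
(* On bounded sequences of the A_n the coefficient at e is asymptotically
   multiplicative: a product of two elements s, t other than e can be e, but their
   contribution to the coefficient of f # g is at most |f| |g| / mu_n(s) mu_n(t)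
   = |f| |g| / n^2.  A properly infinite algebra contains a, b, c, d with
   b a = d c = 1 and b c = d a = 0; lifting them from Asy, the coefficients at e
   would satisfy b_e a_e -> 1, d_e c_e -> 1 and b_e c_e -> 0 while remaining
   bounded, which is impossible in a commutative field.  In each A_n the
   generators of Cu_2 are themselves such elements. *)

Require Import Defs.
From HB Require Import structures.
From mathcomp Require Import all_boot all_order all_algebra.
From mathcomp Require Import boolp classical_sets functions reals topology.
From mathcomp Require Import normedtype sequences esum.
From mathcomp.real_closed Require Import complex.
From mathcomp Require Import ereal lra.

Set Implicit Arguments.
Unset Strict Implicit.
Unset Printing Implicit Defensive.

Import Order.TTheory GRing.Theory Num.Theory.
Import ComplexField.Normc.

Local Open Scope ring_scope.

(** These equations can be checked on point masses and lifted from [Asy] to bounded sequences. From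
    [p = a * b] and [b * a = 1] follows [b * p = b], and likewise [q * c = c]; so [p * q = 0] forces
    [b * c = b * (p * q) * c = 0]. *)
Lemma properly_infiniteP (A : pzRingType) :
  properly_infinite A <->
  exists a b c d : A, [/\ b * a = 1, d * c = 1, b * c = 0 & d * a = 0].
Proof.
split.
  move=> [p [q [_ _ [pq qp] [a [b [pE ba]]] [c [d [qE dc]]]]]].
  exists a, b, c, d; split => //.
    have -> : b * c = b * (p * q) * c.
      by rewrite pE qE !mulrA -ba mul1r -!mulrA -dc mulr1.
    by rewrite pq mulr0 mul0r.
  have -> : d * a = d * (q * p) * a.
    by rewrite pE qE !mulrA -dc mul1r -!mulrA -ba mulr1.
  by rewrite qp mulr0 mul0r.
move=> [a [b [c [d [ba dc bc da]]]]]; exists (a * b), (c * d); split.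
- by rewrite /idempotent_elt mulrA -(mulrA a) ba mulr1.
- by rewrite /idempotent_elt mulrA -(mulrA c) dc mulr1.
- split; first by rewrite mulrA -(mulrA a) bc mulr0 mul0r.
  by rewrite mulrA -(mulrA c) da mulr0 mul0r.
- by exists a, b.
- by exists c, d.
Qed.

Section OneCoefficient.
Variables (R : realType) (S : zmonoidType) (w : weight R S).

(** The pair [(e, e)] contributes exactly [f e * g e]. If one factor of the identity is the
    identity, so is the other; hence in all remaining pairs both weights are at least [k], which
    gains [k ^+ 2] over the product of the norms. *)
Lemma one_coefM (k : R) (f g : l1 w) : 0 < k ->
  (forall s : nonzero S, val s != 1%g -> k <= w (val s)) ->
  normc ((f * g) (one_nz S) - f (one_nz S) * g (one_nz S)) <=
  l1_norm f * l1_norm g / k ^+ 2.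
Proof.
move=> k0 kw; set e := one_nz S; set P := factorizations e.
have w0 s : 0 <= w s by rewrite ltW// weight_gt0.
pose F (p : nonzero S * nonzero S) : R[i] := f p.1 * g p.2.
pose F1 p := if p == (e, e) then F p else 0.
pose F2 p := if p == (e, e) then 0 else F p.
have FS : csummable P F by apply: (@conv_csummable _ _ w); exact: l1P.
have leF (G : nonzero S * nonzero S -> R[i]) :
    (forall p, normc (G p) <= normc (F p)) -> csummable P G.
  by move=> GF; apply: le_nsummable FS => p _.
have nF (G : bool) p : normc (if G then F p else 0) <= normc (F p).
  by case: G => //; rewrite normc0 normc_ge0.
have F1S : csummable P F1 by apply: leF => p; exact: nF.
have F2S : csummable P F2.
  by apply: leF => p; rewrite /F2 -if_neg; exact: nF.
have -> : (f * g) e - f e * g e = csum P F2.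
  have -> : (f * g) e = csum P (fun p => F1 p + F2 p).
    by apply: eq_csum => p _; rewrite /F1 /F2; case: ifP; rewrite ?addr0 ?add0r.
  rewrite csumD// (@csum_only _ _ P F1 (e, e)) /F1 ?eqxx ?[F _]/=.
  - by rewrite addrC addKr.
  - by rewrite /P /factorizations/= mul1g.
  - by move=> p _ /negPf ->.
pose a s := normc (f s); pose b s := normc (g s).
pose G p := (a p.1 * w (val p.1)) * (b p.2 * w (val p.2)).
have G0 p : 0 <= G p by rewrite !mulr_ge0 ?normc_ge0.
(* The weighted sum over all pairs with nonzero product is at most the product of the norms; only
   its block of factorizations of [e] is kept. *)
have GS : (\esum_(p in P) (G p)%:E <= (l1_norm f * l1_norm g)%:E)%E.
  rewrite EFinM !l1_normE.
  have abs0 (h : l1 w) s : 0 <= normc (h s) by exact: normc_ge0.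
  apply: le_trans (fact_bound (abs0 f) (abs0 g) (l1P f) (l1P g)).
  have P0 u : (0 <= \esum_(p in factorizations u) (G p)%:E)%E.
    by apply: esum_ge0 => p _; rewrite lee_fin.
  by rewrite [leRHS](esumID [set e])// setTI esum_set1// leeDl// esum_ge0.
rewrite -lee_fin; apply: le_trans (normc_csum F2S) _.
rewrite mulrC EFinM.
have k20 : 0 <= (k ^+ 2)^-1 by rewrite invr_ge0 exprn_ge0// ltW.
apply: le_trans (lee_wpmul2l _ GS); last by rewrite lee_fin.
rewrite -esumZ//; apply: le_esum => -[s t] st; rewrite lee_fin.
rewrite /F2; case: eqVneq => [|ne]; first by rewrite normc0 mulr_ge0.
rewrite ler_pdivlMl ?exprn_gt0// /F normcM /G /= [leLHS]mulrC [leRHS]mulrACA.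
rewrite ler_wpM2l ?mulr_ge0 ?normc_ge0// expr2 ler_pM ?(ltW k0)//.
  apply: kw; apply: contra ne => /eqP s1.
  move: st; rewrite /P /factorizations/= s1 mul1g => t1.
  by apply/eqP; congr pair; apply: val_inj.
apply: kw; apply: contra ne => /eqP t1.
move: st; rewrite /P /factorizations/= t1 mulg1 => s1.
by apply/eqP; congr pair; apply: val_inj.
Qed.

Lemma l1_coef_le (f : l1 w) s : 1 <= w (val s) -> normc (f s) <= l1_norm f.
Proof.
by move=> ws; apply: le_trans (l1_norm_coef f s); rewrite ler_peMr ?normc_ge0.
Qed.

End OneCoefficient.

Lemma cu2_weight_ge (R : realType) (n : nat) (n0 : (0 < n)%N) (s : nonzero Cu2) :
  val s != 1%g -> n%:R <= cu2_weight R n0 (val s).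
Proof. by move=> s1 /=; rewrite /cu2_weight_fun (negPf s1) (negPf (valP s)). Qed.

(** Under the action on binary words the [b] letters push a bit and the [a] letters pop one. [Lzero]
    sends everything to [None], while each other letter is defined on the word supplied here. *)
Lemma cu2_letter_neq0 l : l <> Lzero -> cu2_class [:: l] != mzero.
Proof.
move=> l0; apply/eqP => /cu2_classP/cu2_act_cong E.
by case: l l0 E => // _ E; [have := E (Some [:: true])|have := E (Some [:: false])|
  have := E (Some [::])|have := E (Some [::])].
Qed.

Lemma l1_cu2_properly_infinite (R : realType) (w : weight R Cu2) :
  properly_infinite (l1_banach w).
Proof.
pose x l (h : l <> Lzero) : nonzero Cu2 := 
  exist (fun s => s != mzero) _ (cu2_letter_neq0 h).
have xM l m (hl : l <> Lzero) (hm : m <> Lzero) :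
    (val (x l hl) * val (x m hm))%g = cu2_class [:: l; m].
  exact: cu2_mulE.
have one l m (hl : l <> Lzero) (hm : m <> Lzero) : cu2_cong [:: l; m] [::] ->
    l1_delta w (x l hl) * l1_delta w (x m hm) = 1.
  move=> /cu2_classP lm; rewrite l1_deltaM xM lm.
  by rewrite (insubT (fun s => s != mzero) (@oneg_neq0 Cu2)).
have zero l m (hl : l <> Lzero) (hm : m <> Lzero) :
    cu2_cong [:: l; m] [:: Lzero] ->
    l1_delta w (x l hl) * l1_delta w (x m hm) = 0.
  by move=> /cu2_classP lm; rewrite l1_deltaM xM lm insubF// eqxx.
have [a1 a2 b1 b2] : [/\ La1 <> Lzero, La2 <> Lzero, Lb1 <> Lzero & Lb2 <> Lzero].
  by [].
apply/properly_infiniteP.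
(* The generators [a_i] are left inverses of the [b_i], so the [b_i] play [a] and [c], and the [a_i]
   play [b] and [d]. *)
exists (l1_delta w (x _ b1)), (l1_delta w (x _ a1)).
exists (l1_delta w (x _ b2)), (l1_delta w (x _ a2)); split.
- exact/one/cu2_a1b1.
- exact/one/cu2_a2b2.
- exact/zero/cu2_a1b2.
- exact/zero/cu2_a2b1.
Qed.

(** Commutativity regroups [(b * a) * (d * c)] as [(b * c) * (a * d)]: the first form has modulus at
    least [(3 / 4) ^+ 2], the second at most [e * (C * C)]. *)
Lemma normc_approx1_product (R : realType) (a b c d : R[i]) (C e : R) :
  normc a <= C -> normc d <= C -> normc (b * a - 1) <= 1 / 4 ->
  normc (d * c - 1) <= 1 / 4 -> normc (b * c) <= e -> 9 / 16 <= e * (C * C).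
Proof.
move=> aC dC ba dc bc.
have near1 (x : R[i]) : normc (x - 1) <= 1 / 4 -> 3 / 4 <= normc x.
  move=> x1; have := ler_normcD (1 - x) x; rewrite subrK normc1 -normcN opprB.
  lra.
have -> : 9 / 16 = (3 / 4) * (3 / 4) :> R by lra.
apply: (@le_trans _ _ (normc (b * a) * normc (d * c))).
  by apply: ler_pM; rewrite ?near1//; lra.
rewrite -normcM [d * c]mulrC mulrACA !normcM -normcM.
by apply: ler_pM; rewrite ?mulr_ge0 ?normc_ge0// ler_pM ?normc_ge0.
Qed.

Section AsyCu2.
Variable R : realType.
Let A (n : nat) : banachAlgebra R := l1_banach (cu2_weight R (ltn0Sn n)).
Let coef (f : linf A) (n : nat) : R[i] :=
  (f n : l1 (cu2_weight R (ltn0Sn n))) (one_nz Cu2).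

(** Two errors of at most [e / 2] add up: that of [one_coefM] with [k = n.+1], and the norm of
    [f n * g n - h n], which dominates its coefficient at the identity. *)
Lemma asy_coefM (f g h : linf A) (e : R) : 0 < e ->
  asy_class f * asy_class g = asy_class h ->
  exists N : nat, forall n, (N <= n)%N ->
    normc (coef f n * coef g n - coef h n) <= e.
Proof.
move=> e0; rewrite -asy_classM => /asy_classP/c0P fgh.
have e2 : 0 < e / 2 by rewrite divr_gt0.
have [N NP] := fgh _ e2.
pose K := linf_norm f * linf_norm g.
have K0 : 0 <= K by rewrite mulr_ge0 ?linf_norm_ge0.
(* For [n >= M] one has [M <= n.+1 <= n.+1 ^ 2], so [K <= (e / 2) * M] yields
   [K / n.+1 ^ 2 <= e / 2]. *)
pose M := Num.bound (K / (e / 2)).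
have MP : K <= (e / 2) * M%:R.
  rewrite mulrC -ler_pdivrMr//; apply/ltW/archi_boundP.
  by rewrite divr_ge0// ltW.
exists (maxn N M) => n; rewrite geq_max => /andP[/NP fgn Mn].
have n0 : (0 : R) < n.+1%:R by rewrite ltr0n.
have fgE := @one_coefM _ _ _ n.+1%:R (f n) (g n) n0 (@cu2_weight_ge R n.+1 _).
have hE := l1_coef_le (f n * g n - h n : l1 (cu2_weight R (ltn0Sn n)))
  (cu2_weight_ge1 R (ltn0Sn n) (val (one_nz Cu2))).
have KE : l1_norm (f n) * l1_norm (g n) / n.+1%:R ^+ 2 <= e / 2.
  rewrite ler_pdivrMr ?exprn_gt0//; apply: (@le_trans _ _ K).
    apply: ler_pM (linf_norm_coef f n) (linf_norm_coef g n).
      exact: (ba_norm_ge0 (f n)).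
    exact: (ba_norm_ge0 (g n)).
  apply: le_trans MP _; rewrite ler_pM2l// expr2 -natrM ler_nat.
  by apply: leq_trans (leqW Mn) (leq_pmulr _ _).
rewrite [leRHS]splitr.
have := ler_normcD (coef f n * coef g n - coef (f * g) n) (coef (f * g) n - coef h n).
rewrite addrA subrK => /le_trans; apply; apply: lerD.
  by rewrite -normcN opprB; exact: le_trans fgE KE.
exact: le_trans hE (ltW fgn).
Qed.

Lemma asy_cu2_not_properly_infinite : ~ properly_infinite (Asy A).
Proof.
move=> /properly_infiniteP[a [b [c [d []]]]].
elim/asy_ind: a => a; elim/asy_ind: b => b.
elim/asy_ind: c => c; elim/asy_ind: d => d ba dc bc _.
(* A common bound for [a] and [d]; the summand 1 makes it positive, so that [C * C] can be divided
   by. *)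
pose C := 1 + linf_norm a + linf_norm d.
have na := linf_norm_ge0 a; have nd := linf_norm_ge0 d.
have C0 : 0 < C * C by rewrite mulr_gt0 /C//; lra.
have q0 : 0 < 1 / 4 :> R by lra.
(* With this tolerance for [b * c], [normc_approx1_product] ends in the absurd [9 / 16 <= 1 / 4]. *)
have e0 : 0 < (1 / 4) / (C * C) by rewrite divr_gt0.
have [N1 H1] := @asy_coefM b a 1 _ q0 ba.
have [N2 H2] := @asy_coefM d c 1 _ q0 dc.
have [N3 H3] := @asy_coefM b c 0 _ e0 bc.
pose n := maxn N1 (maxn N2 N3).
have /H1 h1 : (N1 <= n)%N by rewrite leq_maxl.
have /H2 h2 : (N2 <= n)%N by rewrite /n maxnCA leq_maxl.
have /H3 h3 : (N3 <= n)%N by rewrite /n maxnA leq_maxr.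
have coef1 : coef 1 n = 1.
  by rewrite [LHS]/(delta_fun R (one_nz Cu2) (one_nz Cu2)) /delta_fun eqxx.
have coef0 : coef 0 n = 0 by [].
have coefC x : linf_norm x <= C -> normc (coef x n) <= C.
  move=> xC; apply: le_trans xC; apply: le_trans (linf_norm_coef x n).
  exact/l1_coef_le/(cu2_weight_ge1 R (ltn0Sn n)).
rewrite coef1 in h1 h2; rewrite coef0 subr0 in h3.
have [aC dC] : linf_norm a <= C /\ linf_norm d <= C by split; rewrite /C; lra.
have := normc_approx1_product (coefC a aC) (coefC d dC) h1 h2 h3.
rewrite divfK ?gt_eqF//; lra.
Qed.

End AsyCu2.

(* The sequence is indexed from 0: A n is the algebra with quasi-weight mu_(n+1). *)
Theorem theorem4p11 (R : realType) :
  let A := fun n : nat => l1_banach (cu2_weight R (ltn0Sn n)) in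
  (forall n : nat, properly_infinite (A n)) /\ ~ properly_infinite (Asy A).
Proof.
split; last exact: asy_cu2_not_properly_infinite.
by move=> n; exact: l1_cu2_properly_infinite.
Qed.
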